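(* For each $\nu\ge1$ let $n=n_\nu\ge1$ be an integer, let $d_1,\dots,d_n$ (depending on $\nu$) be non-negative integers with even sum, let $N=N_\nu=\tfrac12\sum_{i} d_i$, and let $G^*(n,(d_i)_1^n)$ be the random multigraph given by the configuration model. Assume that $N\to\infty$ as $\nu\to\infty$. Let $$\lambda_{ij}=\frac{\sqrt{d_i(d_i-1)d_j(d_j-1)}}{2N},\qquad 1\le i,j\le n;$$ in particular $\lambda_{ii}=d_i(d_i-1)/(2N)$. Then, as $\nu\to\infty$, $$\mathbb P\bigl(G^*(n,(d_i)_1^n)\text{ is simple}\bigr)=\exp\Bigl(-\tfrac12\sum_i\lambda_{ii}-\sum_{i<j}\bigl(\lambda_{ij}-\log(1+\lambda_{ij})\bigr)\Bigr)+o(1);$$ equivalently, $$\mathbb P\bigl(G^*(n,(d_i)_1^n)\text{ is simple}\bigr)=\exp\biggl(-\frac14\Bigl(\frac{\sum_i d_i^2}{2N}\Bigr)^2+\frac14+\frac{\sum_i d_i^2(d_i-1)^2}{16N^2}+\sum_{i<j}\bigl(\log(1+\lambda_{ij})-\lambda_{ij}+\tfrac12\lambda_{ij}^2\bigr)\biggr)+o(1).$$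
   Context: Configuration model: given $n\ge1$ and non-negative integers $d_1,\dots,d_n$ with $\sum_i d_i=2N$ even, take pairwise disjoint sets of half-edges, with $d_v$ half-edges belonging to each vertex $v\in\{1,\dots,n\}$ ($2N$ half-edges in total). A configuration is a partition of the set of all half-edges into $N$ pairs. Choose a configuration uniformly at random; $G^*(n,(d_i)_1^n)$ is the random multigraph with vertex set $\{1,\dots,n\}$ in which each pair $\{x,y\}$ of the configuration, with $x$ belonging to $v$ and $y$ belonging to $w$, gives an edge between $v$ and $w$ (a loop if $v=w$). A multigraph is simple if it has no loops and no multiple edges. *)

(* Defs.v *)
From mathcomp Require Import all_boot all_order all_algebra.
From mathcomp Require Import all_classical all_reals all_analysis.

Set Implicit Arguments.
Unset Strict Implicit.
Unset Printing Implicit Defensive.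

Import Order.TTheory GRing.Theory Num.Theory.
Import numFieldNormedType.Exports.

Local Open Scope ring_scope.

(* A multigraph is given by its edge multiplicities; [mult G v v] is the number
   of loops at [v], each loop being counted once. *)
Record multigraph (V : finType) := Multigraph {
  mult : V -> V -> nat;
  mult_sym : forall v w, mult v w = mult w v
}.

Definition simple_multigraph (V : finType) (G : multigraph V) : bool :=
  [forall v, mult G v v == 0%N] && [forall v, forall w, (mult G v w <= 1)%N].

(* Half-edges are pairs (v, k) with k < d v; [tag x] is the vertex of [x]. *)
Definition half_edge (n : nat) (d : 'I_n -> nat) : finType :=
  {v : 'I_n & 'I_(d v)}.

Definition is_configuration (n : nat) (d : 'I_n -> nat)
    (P : {set {set half_edge d}}) : bool :=
  finset.partition P [set: half_edge d]%SET &&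
  [forall p in P, #|p| == 2%N].

Definition configuration (n : nat) (d : 'I_n -> nat) : finType :=
  {P : {set {set half_edge d}} | is_configuration P}.

Definition edges_between (n : nat) (d : 'I_n -> nat) (c : configuration d)
    (v w : 'I_n) : {set {set half_edge d}} :=
  [set p in val c | [exists x, exists y,
     [&& p == [set x; y]%SET, tag x == v & tag y == w]]]%SET.

Lemma edges_betweenC (n : nat) (d : 'I_n -> nat) (c : configuration d)
    (v w : 'I_n) : #|edges_between c v w| = #|edges_between c w v|.
Proof.
apply: eq_card => p; rewrite !inE; congr (_ && _).
by apply/existsP/existsP => -[x /existsP[y /and3P[/eqP-> vx wy]]];
  exists y; apply/existsP; exists x; rewrite finset.setUC eqxx vx wy.
Qed.

Definition config_multigraph (n : nat) (d : 'I_n -> nat)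
    (c : configuration d) : multigraph 'I_n :=
  Multigraph (edges_betweenC c).

Definition uniform_prob (R : realType) (T : finType) (E : pred T) : R :=
  #|E|%:R / #|T|%:R.

Definition prob_simple (R : realType) (n : nat) (d : 'I_n -> nat) : R :=
  uniform_prob R
    (fun c : configuration d => simple_multigraph (config_multigraph c)).

Definition num_edges (n : nat) (d : 'I_n -> nat) : nat := (\sum_i d i)./2.

(* The subtraction is in [R], so the factor for d i = 0 is 0 * (0 - 1) = 0. *)
Definition lambda (R : realType) (n : nat) (d : 'I_n -> nat) (i j : 'I_n) : R :=
  Num.sqrt ((d i)%:R * ((d i)%:R - 1) * (d j)%:R * ((d j)%:R - 1))
  / (2 * (num_edges d)%:R).

(* Main.v *)
Require Import Defs.
From mathcomp Require Import all_boot all_order all_algebra.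
From mathcomp Require Import zify ring lra.

(* Let X_t be the number of configuration edges joining the ends of the vertex
   pair t = {i, j}. The indicator of simplicity is the product over t of the
   indicators X_t = 0 (loops) and X_t <= 1 (non-loops); each of these is a
   series sum_k a_t(k) 'C(X_t, k), and for a Poisson variable of mean y the
   expectation of the series is e^-y, respectively (1 + y) e^-y. Factorial
   moments of the X_t are explicit: they equal
     prod_i d_i (d_i - 1) ... (d_i - s_i + 1) / ((2N-1)(2N-3)...(2N-2K+1))
   up to symmetry factors, s_i being the number of half-edges used at i and K
   the number of edges. Expanding the product, the probability is compared term
   by term with the Poisson expression, in which the falling factorials become
   (d_i (d_i - 1))^(s_i / 2) and the denominator (2N)^K. The two agree for
   s_i = 0, 2, and s_i = 1 never occurs because a_t(1) = 0 for non-loops; for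
   s_i >= 3 a factor d_i^-1 is gained. Both errors are absorbed by the
   absolutely convergent majorant at rescaled arguments, so the difference is
   O(N^(-1/2)) as long as S = sum_i lambda_ii is bounded. If S is large, a second
   moment bound on the number of loops makes the probability small, and the
   exponential is at most e^(-S/2). *)

Set Implicit Arguments.
Unset Strict Implicit.

(** * Perfect matchings and their factorial moments *)

Section Matchings.

Variable H : finType.
Implicit Types (A e : {set H}) (P Q : {set {set H}}).

Definition matchings A : {set {set {set H}}} :=
  [set P | partition P A && [forall e in P, #|e| == 2]].

Lemma matchingsP A P :
  reflect (partition P A /\ forall e, e \in P -> #|e| = 2) (P \in matchings A).
Proof.
rewrite inE; apply: (iffP andP) => -[hP h2]; split=> //.
  by move=> e eP; apply/eqP; move/forall_inP: h2; apply.
by apply/forall_inP => e /h2/eqP.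
Qed.

Lemma matching_edge A P e :
  P \in matchings A -> e \in P -> (e \subset A) && (#|e| == 2).
Proof.
case/matchingsP=> hP h2 eP; rewrite (h2 _ eP) eqxx andbT.
by rewrite -(cover_partition hP); apply: bigcup_sup.
Qed.

(** Matchings of [A] that contain [e] correspond to matchings of [A :\: e]. The conjunct
    [(e |: Q) :\ e == Q] says that [e] is not already in [Q], in the form in which [reindex_onto]
    asks for it. *)
Lemma matchings_add_edge A e Q : e \subset A -> #|e| = 2 ->
  (e |: Q \in matchings A) && ((e |: Q) :\ e == Q) =
  (Q \in matchings (A :\: e)).
Proof.
move=> eA e2; apply/andP/idP.
  case=> /matchingsP[hP h2] /eqP hQ; apply/matchingsP; split.
    by rewrite -hQ; apply: partitionD1 => //; rewrite setU11.
  by move=> f fQ; apply: h2; rewrite inE fQ orbT.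
case/matchingsP=> hP h2.
have e0 : e != set0 by rewrite -card_gt0 e2.
have dis : [disjoint e & A :\: e].
  by rewrite -setI_eq0; apply/eqP/setP=> x; rewrite !inE; case: (x \in e).
have eNQ : e \notin Q.
  apply/negP=> eQ; case/set0Pn: e0 => x xe.
  have : x \in A :\: e by rewrite -(cover_partition hP); apply/bigcupP; exists e.
  by rewrite inE xe.
split; last by rewrite setU1K.
apply/matchingsP; split.
  by rewrite -[A](setID A e) (setIidPr eA); apply: partitionU1.
by move=> f; rewrite !inE => /orP[/eqP->|/h2].
Qed.

(** Double counting of the pairs formed by a matching and one of its edges. All the matching counts
    below come from this recursion. *)
Lemma sum_matchings_edges A (F : {set H} -> {set {set H}} -> nat) :
  \sum_(P in matchings A) \sum_(e in P) F e (P :\ e) =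
  \sum_(e : {set H} | (e \subset A) && (#|e| == 2))
    \sum_(Q in matchings (A :\: e)) F e Q.
Proof.
rewrite (exchange_big_dep (fun e => (e \subset A) && (#|e| == 2))) /=; last first.
  by move=> P e; exact: matching_edge.
apply: eq_bigr => e /andP[eA /eqP e2].
rewrite (reindex_onto (fun Q => e |: Q) (fun P => P :\ e)) /=; last first.
  by move=> P /andP[_ eP]; rewrite setD1K.
apply: eq_big => [Q|Q /andP[_ /eqP->] //].
by rewrite setU11 andbT matchings_add_edge.
Qed.

End Matchings.

(** * Vertex pairs and the edges joining their ends *)

Section Types.

(** Unordered pairs with repetition: each possible edge position, loops included, has exactly one
    representative. *)
Definition vertex_pair (n : nat) : finType := {p : 'I_n * 'I_n | p.1 <= p.2}.

Variable n : nat.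
Implicit Types (t u : vertex_pair n) (i j : 'I_n).

Definition fst_end t := (val t).1.
Definition snd_end t := (val t).2.
Definition is_loop t := fst_end t == snd_end t.
Definition incidence t i : nat := (fst_end t == i) + (snd_end t == i).
Definition symmetry_factor t : nat := (is_loop t).+1.

Lemma end_le t : fst_end t <= snd_end t. Proof. exact: valP t. Qed.

Lemma incidence_inj t u : incidence t =1 incidence u -> t = u.
Proof.
have ht := end_le t; have hu := end_le u => h.
have [h1 h2] : fst_end t = fst_end u /\ snd_end t = snd_end u.
  move: (h (fst_end t)) (h (snd_end t)) (h (fst_end u)) (h (snd_end u)).
  rewrite /incidence !eqxx -!(inj_eq val_inj) /= => h1 h2 h3 h4.
  by split; apply: val_inj => /=; lia.
apply: val_inj; rewrite [val t]surjective_pairing [val u]surjective_pairing.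
by congr pair.
Qed.

Variables (H : finType) (c : H -> 'I_n).
Implicit Types (A e : {set H}) (P Q : {set {set H}}).

Definition degree A i := #|[set x in A | c x == i]|.
(** Formulated through degrees so that the two half-edges of [e] need not be ordered. *)
Definition joins t e := [forall i, degree e i == incidence t i].
Definition multiplicity t P := \sum_(e in P) joins t e.

Lemma sum_degree A : \sum_i degree A i = #|A|.
Proof.
rewrite -sum1_card (partition_big c predT) //=.
by apply: eq_bigr => i _; rewrite /degree -sum1_card; apply: eq_bigl => x; rewrite !inE.
Qed.

Lemma degree2 x y i : x != y -> degree [set x; y] i = (c x == i) + (c y == i).
Proof.
move=> xy; rewrite /degree -sum1_card big_mkcond /=.
have yx : y != x by rewrite eq_sym.
rewrite (bigD1 x) //= (bigD1 y) //= big1 ?addn0.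
  by rewrite !inE !eqxx orbT /=; case: (c x == i); case: (c y == i).
by move=> z /andP[zx zy]; rewrite !inE (negPf zx) (negPf zy).
Qed.

Lemma sum_incidence t : \sum_i incidence t i = 2.
Proof.
rewrite big_split /= (bigD1 (fst_end t)) //= eqxx big1 => [|i]; last first.
  by rewrite eq_sym => /negPf->.
rewrite (bigD1 (snd_end t)) //= eqxx big1 // => i.
by rewrite eq_sym => /negPf->.
Qed.

Lemma joinsP t e : reflect (degree e =1 incidence t) (joins t e).
Proof. by apply: (iffP forallP) => h i; apply/eqP. Qed.

Lemma joins_card t e : joins t e -> #|e| = 2.
Proof.
by move/joinsP=> h; rewrite -sum_degree (eq_bigr _ (fun i _ => h i)) sum_incidence.
Qed.

Lemma joins_uniq t u e : joins u e -> joins t e = (t == u).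
Proof.
move/joinsP=> hu; apply/joinsP/eqP=> [ht|-> //].
by apply: incidence_inj => i; rewrite -hu -ht.
Qed.

Lemma joins_endsP t e :
  reflect (exists x y, [/\ x != y, e = [set x; y], c x = fst_end t & c y = snd_end t])
    (joins t e).
Proof.
apply: (iffP idP) => [je|[x [y [xy -> cx cy]]]]; last first.
  by apply/joinsP=> i; rewrite degree2 // cx cy.
have /eqP/cards2P[x [y [xy he]]] := joins_card je.
move/joinsP: je => je; have := je (fst_end t); have := je (snd_end t).
rewrite he !degree2 // /incidence !eqxx.
have [cx|ncx] := eqVneq (c x) (fst_end t).
  move=> h _; exists x, y; split=> //; apply/eqP.
  by move: h; rewrite cx; do 2 case: (_ == snd_end t).
have [cy|ncy] := eqVneq (c y) (fst_end t); last by move=> _; case: (_ == _).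
rewrite cy => h1 h2; exists y, x; rewrite eq_sym [_ |: _]setUC; split=> //.
move: h1 h2; rewrite [fst_end t == _]eq_sym; case: (snd_end t == _) => //.
by case: (c x =P snd_end t).
Qed.

Lemma degreeD A e i : e \subset A -> degree (A :\: e) i = degree A i - degree e i.
Proof.
move=> eA; rewrite /degree.
rewrite (_ : [set x in A :\: e | c x == i] =
   [set x in A | c x == i] :\: [set x in e | c x == i]).
  rewrite cardsD; congr (_ - _); apply: eq_card => x; rewrite !inE.
  by case: (boolP (x \in e)) => [/(subsetP eA)->|]; case: (_ == _); rewrite ?andbF.
by apply/setP=> x; rewrite !inE; do !case: (_ \in _); case: (_ == _).
Qed.

Lemma multiplicityD1 t P e : e \in P ->
  multiplicity t P = joins t e + multiplicity t (P :\ e).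
Proof.
move=> eP; rewrite /multiplicity (bigD1 e) //=; congr addn.
by apply: eq_bigl => f; rewrite !inE andbC.
Qed.

(** The right side counts ordered pairs of distinct half-edges at the two ends. At a loop each edge
    arises from two orders, hence the factor 2; at a non-loop the map from pairs to sets is
    injective, since the two ends differ. *)
Lemma card_joins t A :
  #|[set e : {set H} | (e \subset A) && joins t e]| * symmetry_factor t =
  \prod_i (degree A i) ^_ (incidence t i).
Proof.
rewrite /symmetry_factor; case: (boolP (is_loop t)) => /eqP ht /=.
  rewrite (bigD1 (fst_end t)) //= big1 ?muln1; last first.
    by move=> i; rewrite /incidence -ht eq_sym => /negPf->.
  rewrite /incidence -ht !eqxx -bin_ffact; congr (_ * _).
  rewrite /degree -cards_draws; apply: eq_card => e; rewrite !inE.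
  apply/andP/andP.
    case=> eA je; rewrite (joins_card je); split=> //.
    case/joins_endsP: je eA => x [y [_ -> cx cy]] /subsetP eA; rewrite -ht in cy.
    by apply/subsetP=> z ze; rewrite inE eA //=; case/set2P: ze => ->; rewrite ?cx ?cy.
  case=> /subsetP hs /cards2P[x [y [xy he]]]; split.
    by apply/subsetP=> z /hs; rewrite inE => /andP[].
  have := hs x; have := hs y; rewrite he !inE !eqxx orbT /=.
  move=> /(_ isT)/andP[_ /eqP cy] /(_ isT)/andP[_ /eqP cx].
  by apply/joins_endsP; exists x, y; rewrite -ht.
have ne : snd_end t != fst_end t by apply/eqP => h; apply: ht.
have ne' : fst_end t != snd_end t by apply/eqP.
rewrite (bigD1 (fst_end t)) //= (bigD1 (snd_end t)) //= big1 ?muln1; last first.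
  by move=> i /andP[h1 h2]; rewrite /incidence !(eq_sym _ i) (negPf h1) (negPf h2).
rewrite /incidence !eqxx (negPf ne) (negPf ne') /= !ffactn1 /degree -cardsX.
set B := setX _ _.
rewrite -(card_in_imset (f := fun p : H * H => [set p.1; p.2]) (D := mem B)); last first.
  move=> [x y] [x' y']; rewrite !inE /= => /andP[/andP[_ /eqP hx] /andP[_ /eqP hy]].
  move=> /andP[/andP[_ /eqP hx'] /andP[_ /eqP hy']] /setP he.
  move: (he x) (he y); rewrite !inE !eqxx orbT /=.
  move=> /esym/orP[/eqP->|/eqP xy']; last by case: ht; rewrite -hx -hy' xy'.
  move=> /esym/orP[/eqP yx'|/eqP->//]; by case: ht; rewrite -hy -hx' yx'.
apply: eq_card => e; rewrite !inE; apply/andP/imsetP.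
  case=> /subsetP eA /joins_endsP[x [y [_ he cx cy]]]; exists (x, y) => //.
  by rewrite !inE /= cx cy !eqxx !eA // he !inE eqxx ?orbT.
case=> -[x y]; rewrite !inE /= => /andP[/andP[xA /eqP cx] /andP[yA /eqP cy]] ->.
split; first by apply/subsetP=> z; rewrite !inE => /orP[]/eqP->.
apply/joins_endsP; exists x, y; split=> //.
by apply: contraNneq ne => xy; rewrite -cx -cy xy.
Qed.

End Types.

(** * Number of matchings and joint factorial moments of multiplicities *)

Section FactorialMoments.

(** The double factorial (2N-1)!!, which is the number of perfect matchings of 2N points. *)
Definition odd_factorial N := \prod_(j < N) (2 * j).+1.

Lemma odd_factorialS N : odd_factorial N.+1 = (2 * N).+1 * odd_factorial N.
Proof. by rewrite /odd_factorial big_ord_recr /= mulnC. Qed.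

Lemma odd_factorial_gt0 N : 0 < odd_factorial N.
Proof. by apply: prodn_gt0. Qed.

Variable H : finType.
Implicit Types (A e : {set H}) (P Q : {set {set H}}).

Lemma card_matching A P M : #|A| = 2 * M -> P \in matchings A -> #|P| = M.
Proof.
move=> hA /matchingsP[hP h2]; have := card_uniform_partition h2 hP.
by rewrite hA mulnC => /eqP; rewrite eqn_pmul2r // => /eqP.
Qed.

Lemma card_setD_edge A e M : #|A| = 2 * M.+1 ->
  (e \subset A) && (#|e| == 2) -> #|A :\: e| = 2 * M.
Proof. by move=> hA /andP[eA /eqP e2]; rewrite cardsD (setIidPr eA) hA e2; lia. Qed.

Lemma card_matchings A M : #|A| = 2 * M -> #|matchings A| = odd_factorial M.
Proof.
elim: M A => [|M IH] A hA.
  have -> : A = set0 by apply/eqP; rewrite -cards_eq0 hA.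
  rewrite /odd_factorial big_ord0 -(cards1 (set0 : {set {set H}})).
  apply: eq_card => P; rewrite inE [in RHS]inE partition_set0.
  case: eqP => // ->; apply/forall_inP=> e; by rewrite inE.
have := sum_matchings_edges A (fun _ _ => 1).
rewrite (eq_bigr (fun _ => M.+1)) => [|P hP]; last first.
  by rewrite sum1_card (card_matching hA).
rewrite [RHS](eq_bigr (fun _ => odd_factorial M)); last first.
  by move=> e he; rewrite sum1_card IH // (card_setD_edge hA).
rewrite !sum_nat_const (_ : #|_| * odd_factorial M = 'C(2 * M.+1, 2) * odd_factorial M).
  2: by rewrite -hA -cards_draws; congr muln; apply: eq_card => e; rewrite !inE.
rewrite bin2 odd_factorialS.
rewrite (_ : (2 * M.+1 * (2 * M.+1).-1)./2 = M.+1 * (2 * M).+1); last first.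
  by rewrite -mulnA mul2n doubleK; congr muln; lia.
by move/eqP; rewrite mulnC -mulnA eqn_pmul2l // => /eqP.
Qed.

Variables (n : nat) (c : H -> 'I_n).
Implicit Types (t u : vertex_pair n) (m : vertex_pair n -> nat) (i : 'I_n).

(** The degree s_i at [i] of the multigraph that has [m t] edges at each pair [t]. *)
Definition vertex_degree m i := \sum_t m t * incidence t i.

Definition decr m u t := m t - (t == u).

Lemma vertex_degree_decr m u i : 0 < m u ->
  vertex_degree m i = incidence u i + vertex_degree (decr m u) i.
Proof.
move=> mu; rewrite /vertex_degree /decr (bigD1 u) //= [in RHS](bigD1 u) //= eqxx.
rewrite addnA; congr addn; first by rewrite -mulSn; congr muln; lia.
by apply: eq_bigr => t /negPf->; rewrite subn0.
Qed.

Lemma ffactD d a b : d ^_ (a + b) = d ^_ a * (d - a) ^_ b.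
Proof.
elim: a d => [|a IH] [|d]; rewrite ?mul1n //= ?subn0 //.
by rewrite addSn !ffactSS IH subSS mulnA.
Qed.

(** Induction on the number K of prescribed edges: choose [u] with [m u > 0], sum over the edge that
    serves as its first copy, and delete that edge. If K exceeds M, the subtraction truncates to 0,
    but then the vertex degrees add up to more than 2M and some falling factorial vanishes. *)
Lemma sum_matchings_ffact A M m : #|A| = 2 * M ->
  (\sum_(P in matchings A) \prod_t (multiplicity c t P) ^_ (m t))
    * \prod_t symmetry_factor t ^ m t =
  (\prod_i (degree c A i) ^_ (vertex_degree m i)) * odd_factorial (M - \sum_t m t).
Proof.
move: {2}(\sum_t m t) (erefl (\sum_t m t)) => K hK.
elim: K => [|K IH] in A M m hK * => hA.
  have m0 t : m t = 0 by apply/eqP; move/eqP: hK; rewrite sum_nat_eq0 => /forallP/(_ t).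
  rewrite hK subn0 -(card_matchings hA).
  rewrite (eq_bigr (fun=> 1)) => [|P _]; last by rewrite big1 // => t _; rewrite m0.
  rewrite sum1_card [X in _ * X]big1 => [|t _]; last by rewrite m0.
  by rewrite muln1 big1 ?mul1n // => i _; rewrite /vertex_degree big1 // => t _; rewrite m0.
have [u mu] : exists u, 0 < m u.
  apply/existsP; apply: contraPT hK => /existsPn h.
  by rewrite big1 // => t _; apply/eqP; have := h t; rewrite lt0n negbK.
have hK' : \sum_t decr m u t = K.
  move: hK; rewrite (bigD1 u) //= [in X in _ -> X](bigD1 u) //= /decr eqxx.
  rewrite (eq_bigr (fun t => m t - (t == u))) => [|t /negPf->]; last by rewrite subn0.
  move: (\sum_(i | _) _) => x; rewrite subn1; lia.
(* X^_(k+1) = X (X-1)^_k is applied at [u], with the factor X written as a sum over edges; deleting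
   an edge that joins the ends of [u] lowers exactly that multiplicity by one. *)
have step P : \prod_t (multiplicity c t P) ^_ (m t) =
    \sum_(e in P) joins c u e * \prod_t (multiplicity c t (P :\ e)) ^_ (decr m u t).
  transitivity (\sum_(e in P) joins c u e *
      \prod_t (multiplicity c t P - (t == u)) ^_ (decr m u t)).
    rewrite -big_distrl /= -/(multiplicity c u P) (bigD1 u) //= [in RHS](bigD1 u) //=.
    rewrite /decr eqxx mulnA; congr muln.
      by rewrite -{1}(prednK mu) ffactnS !subn1.
    by apply: eq_bigr => t /negPf->; rewrite !subn0.
  apply: eq_bigr => e eP; case: (boolP (joins c u e)) => [je|]; last by rewrite !mul0n.
  congr muln; apply: eq_bigr => t _; congr falling_factorial.
  by rewrite (multiplicityD1 c t eP) (joins_uniq t je) addKn.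
rewrite (eq_bigr _ (fun P _ => step P)).
rewrite (sum_matchings_edges A (fun e Q =>
  joins c u e * \prod_t (multiplicity c t Q) ^_ (decr m u t))).
have symE : \prod_t symmetry_factor t ^ m t =
    symmetry_factor u * \prod_t symmetry_factor t ^ decr m u t.
  rewrite (bigD1 u) //= [in RHS](bigD1 u) //= /decr eqxx mulnA -expnS subn1 prednK //.
  by congr muln; apply: eq_bigr => t /negPf->; rewrite subn0.
rewrite symE mulnCA big_distrl /=.
set D := \prod_i (degree c A i - incidence u i) ^_ (vertex_degree (decr m u) i)
   * odd_factorial (M - K.+1).
rewrite (eq_bigr (fun e : {set H} => joins c u e * D)) => [|e he]; last first.
  rewrite -big_distrr /= -mulnA.
  case: (boolP (joins c u e)) => [/joinsP je|]; last by rewrite !mul0n.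
  (* For M = 0 the empty set [A] contains no edge [e]. *)
  case: M hA @D => [|M] hA D.
    move: he => /andP[eA /eqP e2]; have := subset_leq_card eA.
    by rewrite hA e2.
  rewrite (IH _ M _ hK' (card_setD_edge hA he)) hK' /D subSS; congr (_ * (_ * _)).
  apply: eq_bigr => i _; rewrite degreeD ?je //; by case/andP: he.
rewrite -big_distrl /= mulnA.
have -> : \sum_(e : {set H} | (e \subset A) && (#|e| == 2)) joins c u e =
    #|[set e : {set H} | (e \subset A) && joins c u e]|.
  rewrite -sum1_card big_mkcond [RHS]big_mkcond /=; apply: eq_bigr => e _.
  rewrite inE; case: (e \subset A) => //=.
  by case: (boolP (joins c u e)) => [/joins_card->|_] //=; case: ifP.
rewrite [symmetry_factor u * _]mulnC card_joins /D mulnA -big_split /= hK.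
congr muln; apply: eq_bigr => i _.
by rewrite (vertex_degree_decr i mu) ffactD.
Qed.

End FactorialMoments.

(** * First and second moments of the number of loops *)

Section Loops.

Lemma big_vertex_pair (T : Type) (x : T) (op : Monoid.com_law x) n
    (F : 'I_n -> 'I_n -> T) :
  \big[op/x]_(t : vertex_pair n) F (fst_end t) (snd_end t) =
  \big[op/x]_(i < n) op (F i i) (\big[op/x]_(j < n | i < j) F i j).
Proof.
transitivity (\big[op/x]_(p : 'I_n * 'I_n | p.1 <= p.2) F p.1 p.2).
  symmetry; rewrite (reindex_omap (val : vertex_pair n -> 'I_n * 'I_n) insub) /=; last first.
    by move=> p hp; rewrite insubT.
  by apply: eq_bigl => t; rewrite (valP t) valK eqxx.
rewrite -(pair_big_dep predT (fun i j : 'I_n => i <= j) F) /=.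
apply: eq_bigr => i _; rewrite (bigD1 i) //=; congr (op _ _).
by apply: eq_bigl => j; rewrite [RHS]ltn_neqAle andbC eq_sym.
Qed.

Variables (H : finType) (n : nat) (c : H -> 'I_n).
Implicit Types (A B e : {set H}) (P Q : {set {set H}}).

Definition loop_edge e := \sum_(t : vertex_pair n | is_loop t) joins c t e.
Definition loops P := \sum_(e in P) loop_edge e.
(** The number of two-element subsets of [A] that would form a loop, whether or not a given matching
    uses them. *)
Definition potential_loops A :=
  \sum_(e : {set H} | (e \subset A) && (#|e| == 2)) loop_edge e.

Lemma loop_edge_le1 e : loop_edge e <= 1.
Proof.
rewrite /loop_edge; case: (pickP (fun t : vertex_pair n => is_loop t && joins c t e)).
  move=> u /andP[lu ju]; rewrite (bigD1 u) //= ju big1 // => t /andP[_ tu].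
  by rewrite (joins_uniq t ju) (negPf tu).
by move=> h; rewrite big1 // => t lt; have := h t; rewrite lt /= => ->.
Qed.

Lemma sum_loops A M : #|A| = 2 * M.+1 ->
  \sum_(P in matchings A) loops P = potential_loops A * odd_factorial M.
Proof.
move=> hA; rewrite (sum_matchings_edges A (fun e _ => loop_edge e)) big_distrl /=.
apply: eq_bigr => e he; rewrite sum_nat_const (card_matchings (card_setD_edge hA he)).
by rewrite mulnC.
Qed.

Lemma leq_potential_loops A B : A \subset B -> potential_loops A <= potential_loops B.
Proof.
move=> AB; rewrite /potential_loops big_mkcond [in leqRHS]big_mkcond /=.
apply: leq_sum => e _; case: (boolP (e \subset A)) => [/subset_trans/(_ AB)->|] //.
Qed.

(** The square of the number of loops is the number of loops plus the number of ordered pairs of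
    distinct loops. The second loop of a pair lies in [A :\: e], whose potential loops are only
    bounded by those of [A]; hence an inequality. *)
Lemma sum_sqr_loops A M : #|A| = 2 * M.+2 ->
  \sum_(P in matchings A) loops P ^ 2 <=
  potential_loops A * odd_factorial M.+1 + potential_loops A ^ 2 * odd_factorial M.
Proof.
move=> hA; rewrite -sum_loops //.
rewrite (eq_bigr (fun P => loops P + \sum_(e in P) loop_edge e * loops (P :\ e))).
  rewrite big_split /= leq_add2l.
  rewrite (sum_matchings_edges A (fun e Q => loop_edge e * loops Q)).
  rewrite -mulnn -mulnA big_distrl /=; apply: leq_sum => e he.
  rewrite -big_distrr /= leq_mul2l (sum_loops (card_setD_edge hA he)).
  by rewrite leq_mul2r leq_potential_loops ?orbT // subsetDl.
move=> P _; rewrite -mulnn {1 3}/loops big_distrl -big_split /=.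
apply: eq_bigr => e eP; rewrite /loops (bigD1 e) //= mulnDr; congr addn.
  by have := loop_edge_le1 e; case: (loop_edge e) => [|[]].
by congr muln; apply: eq_bigl => f; rewrite !inE andbC.
Qed.

Lemma potential_loopsE A : 2 * potential_loops A = \sum_i degree c A i ^_ 2.
Proof.
transitivity (\sum_(t : vertex_pair n)
    (fst_end t == snd_end t) * degree c A (fst_end t) ^_ 2); last first.
  rewrite (big_vertex_pair _ (fun i j => (i == j) * degree c A i ^_ 2)) /=.
  apply: eq_bigr => i _; rewrite eqxx mul1n big1 ?addn0 // => j ij.
  by rewrite -val_eqE /= ltn_eqF.
rewrite /potential_loops exchange_big /= big_distrr big_mkcond /=.
apply: eq_bigr => t _; rewrite -/(is_loop t); case: ifP => // lt.
rewrite mul1n; have := card_joins c t A; rewrite /symmetry_factor lt.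
rewrite (bigD1 (fst_end t)) //= big1 ?muln1 => [|i]; last first.
  by rewrite /incidence -(eqP lt) eq_sym => /negPf->.
rewrite /incidence -(eqP lt) !eqxx => <-; rewrite mulnC; congr muln.
rewrite -sum1_card big_mkcond [RHS]big_mkcond /=; apply: eq_bigr => e _.
rewrite inE; case: (e \subset A) => //=.
by case: (boolP (joins c t e)) => [/joins_card->|_] //=; case: ifP.
Qed.

End Loops.

Import Order.TTheory GRing.Theory Num.Theory.

(** * Falling factorials and powers *)

Section NatEstimates.

(** Bernoulli's inequality (N/(N+1))^h >= 1 - h/(N+1), whose right side is at least 1/2 here. *)
Lemma expn_succ_le2 N h : 0 < N -> h.*2 <= N.+1 -> N.+1 ^ h <= 2 * N ^ h.
Proof.
move=> N0 hN.
have bernoulli k : k <= N.+1 -> (N.+1 - k) * N.+1 ^ k <= N ^ k * N.+1.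
  elim: k => [|k IH] kN; first by rewrite subn0 !expn0 mul1n muln1.
  have {}IH := IH (ltnW kN); rewrite !expnS.
  have h1 : (N.+1 - k.+1) * N.+1 <= N * (N.+1 - k) by nia.
  apply: (@leq_trans (N * ((N.+1 - k) * N.+1 ^ k))).
    by rewrite !mulnA leq_mul2r h1 orbT.
  by rewrite -mulnA leq_mul2l IH orbT.
have := bernoulli h; have : N.+1 <= 2 * (N.+1 - h) by lia.
by move: (N.+1 - h) (N.+1 ^ h) (N ^ h) => a b e; nia.
Qed.

(** The exponent is split into two halves, each of which costs a factor 2. *)
Lemma expn_succ_le4 N K : K <= N -> N.+1 ^ K <= 4 * N ^ K.
Proof.
case: N => [|N] KN; first by have -> : K = 0 by lia.
rewrite -(odd_double_half K) -addnn addnA !expnD.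
rewrite -[4]/(2 * 2) mulnACA; apply: leq_mul; last first.
  by apply: expn_succ_le2 => //; lia.
by rewrite -!expnD; apply: expn_succ_le2 => //; lia.
Qed.

Lemma odd_factorial_upper N K : K <= N ->
  odd_factorial N <= (2 * N) ^ K * odd_factorial (N - K).
Proof.
elim: K => [|K IH] KN; first by rewrite expn0 mul1n subn0.
apply: (leq_trans (IH (ltnW KN))); rewrite expnSr -mulnA leq_mul2l.
by rewrite -[N - K](_ : (N - K.+1).+1 = _) ?odd_factorialS ?leq_mul2r; lia.
Qed.

(** Each induction step passes from N+1 to N. It costs a factor 4 for changing the base of the
    power, and a factor 2 from 2(N+1) <= 2(2N+1). *)
Lemma odd_factorial_ratio_le N K : K <= N ->
  (2 * N) ^ K * odd_factorial (N - K) <= 8 ^ K * odd_factorial N.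
Proof.
elim: K N => [|K IH] N KN; first by rewrite subn0 !expn0.
case: N KN => // N KN.
rewrite subSS odd_factorialS.
have h1 := IH N KN; have h2 := @expn_succ_le4 N K KN.
rewrite !expnMn in h1 *; rewrite !expnS.
move: (N.+1 ^ K) (N ^ K) (2 ^ K) (8 ^ K) (odd_factorial (N - K))
  (odd_factorial N) h1 h2 => a b p e o o' h1 h2.
apply: (@leq_trans (8 * N.+1 * (p * b * o))).
  rewrite (_ : _ * o = 2 * N.+1 * p * o * a); last by ring.
  rewrite (_ : 8 * _ * _ = 2 * N.+1 * p * o * (4 * b)); last by ring.
  by rewrite leq_mul2l h2 orbT.
rewrite [leqRHS]mulnACA; apply: leq_mul => //.
by rewrite leq_mul2l ltnS mul2n -addnn leq_addr.
Qed.

Lemma leq_ffact_exp d s : d ^_ s <= d ^ s.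
Proof.
rewrite ffact_prod -[s in leqRHS]card_ord -prod_nat_const.
by apply: leq_prod => i _; exact: leq_subr.
Qed.

End NatEstimates.

(** * Comparison of a single term with its Poisson counterpart *)

Section Estimates.
Local Open Scope ring_scope.
Variable R : realFieldType.

(** The quotient of the double factorials is (2N)^K times the product of 1 - (2j+1)/(2N) over j < K.
    That product is at least one minus the sum of the fractions, and the first K odd numbers add up
    to K^2. *)
Lemma odd_factorial_lower (N K : nat) : (K <= N)%N -> (0 < N)%N ->
  (2 * N)%:R ^+ K * (1 - K%:R ^+ 2 / (2 * N)%:R) * (odd_factorial (N - K))%:R
    <= (odd_factorial N)%:R :> R.
Proof.
move=> KN N0; elim: K KN => [|K IH] KN; first by rewrite subn0 expr0 expr0n /= mul0r subr0 !mul1r.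
apply: le_trans (IH (ltnW KN)).
have -> : (N - K)%N = (N - K.+1).+1 by lia.
rewrite odd_factorialS [(_ * odd_factorial _)%:R]natrM mulrA.
apply: ler_wpM2r => //; rewrite exprSr -!mulrA.
apply: ler_wpM2l; first by rewrite exprn_ge0.
have q0 : 0 < (2 * N)%:R :> R by rewrite ltr0n; lia.
have -> : ((2 * (N - K.+1)).+1)%:R = (2 * N)%:R - 2 * K%:R - 1 :> R.
  rewrite (_ : (2 * (N - K.+1)).+1 = (2 * N - (2 * K).+1)%N); last by lia.
  by rewrite natrB; [rewrite -natr1 [(2 * K)%:R]natrM; ring|lia].
have K0 : 0 <= K%:R :> R by [].
rewrite -[K.+1%:R]natr1; move: q0 K0; move: ((2 * N)%:R : R) (K%:R : R) => q k q0 k0.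
rewrite -subr_ge0.
rewrite (_ : _ - _ = k ^+ 2 * (2 * k + 1) / q); last by field; rewrite gt_eqF.
by apply: divr_ge0; [apply: mulr_ge0; [exact: sqr_ge0|lra]|exact: ltW].
Qed.

(** Telescoping: the factors are exchanged one at a time, and the remaining [f j] are bounded by
    [g j]. *)
Lemma prodr_sub_le (I : finType) (f g b : I -> R) :
  (forall i, 0 <= f i <= g i) -> (forall i, g i - f i <= b i) ->
  \prod_i g i - \prod_i f i <= \sum_i \prod_j (if j == i then b i else g j).
Proof.
move=> fg hb.
suff h (r : seq I) : uniq r -> \prod_(i <- r) g i - \prod_(i <- r) f i <=
    \sum_(i <- r) \prod_(j <- r) (if j == i then b i else g j).
  by apply: h; exact: index_enum_uniq.
elim: r => [|a r IH] /=; first by rewrite !big_nil subrr.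
case/andP=> ar /IH {}IH; rewrite !big_cons eqxx.
have G0 : 0 <= \prod_(i <- r) g i.
  by apply: prodr_ge0 => i _; have /andP[/le_trans] := fg i; apply.
have -> : \prod_(j <- r) (if j == a then b a else g j) = \prod_(j <- r) g j.
  by apply: eq_big_seq => j jr; case: eqP => // ja; rewrite -ja jr in ar.
have -> : \sum_(j <- r) \prod_(i <- a :: r) (if i == j then b j else g i) =
   g a * \sum_(j <- r) \prod_(i <- r) (if i == j then b j else g i).
  rewrite big_distrr; apply: eq_big_seq => j jr; rewrite big_cons.
  by case: eqP => // ja; rewrite ja jr in ar.
have /andP[fa0 fga] := fg a.
have := ler_wpM2r G0 (hb a).
have D0 : 0 <= \prod_(i <- r) g i - \prod_(i <- r) f i.
  by rewrite subr_ge0; apply: ler_prod => i _; exact: fg.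
have := ler_wpM2r D0 fga; have := ler_wpM2l (le_trans fa0 fga) IH.
by lra.
Qed.

(** The first two factors multiply to exactly z^2 and the later ones are at most z. The bound fails
    at s = 1 for every d >= 1, since then d > z. *)
Lemma ffact_le_pow (d s : nat) (z : R) : 0 <= z -> z ^+ 2 = d%:R * (d%:R - 1) ->
  s != 1%N -> (d ^_ s)%:R <= z ^+ s.
Proof.
move=> z0 hz; case: s => [|[|s]] // _.
case: d hz => [|[|d]] hz; try by rewrite exprn_ge0.
have dz : d%:R + 1 <= z.
  rewrite -(ler_pXn2r (n := 2)) ?nnegrE ?addr_ge0 // hz -!natr1.
  by have : 0 <= d%:R :> R by []; nra.
rewrite !ffactSS mulnA natrM -[s.+2]/(2 + s)%N exprD; apply: ler_pM => //.
  by rewrite hz natrM -!natr1; lra.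
apply: (@le_trans _ _ (d%:R ^+ s)).
  by rewrite -natrX ler_nat leq_ffact_exp.
by apply: lerXn2r; rewrite ?nnegrE //; lra.
Qed.

Lemma pow_sub_ffact_le (d s : nat) :
  d%:R ^+ s.+1 - (d ^_ s.+1)%:R <= s.+1%:R ^+ 2 * d%:R ^+ s :> R.
Proof.
elim: s => [|s IH]; first by rewrite ffactn1 expr1 subrr expr0 mulr1 sqr_ge0.
rewrite ffactnSr natrM [_ ^+ s.+2]exprSr.
have h1 : d%:R - s.+1%:R <= (d - s.+1)%:R :> R.
  by rewrite lerBlDr -natrD ler_nat; lia.
have h2 := ler_wpM2l (ler0n R (d ^_ s.+1)) h1.
have h3 := ler_wpM2r (ler0n R d) IH.
have h5 : (d ^_ s.+1)%:R <= d%:R ^+ s.+1 :> R by rewrite -natrX ler_nat leq_ffact_exp.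
have h4 := ler_wpM2r (ler0n R s.+1) h5.
rewrite -mulrA -exprSr in h3.
rewrite -[s.+2%:R]natr1; set S := s.+1%:R in h1 h2 h3 h4 *.
have S0 : 0 <= S by [].
have P0 : 0 <= d%:R ^+ s.+1 :> R by rewrite exprn_ge0.
by nra.
Qed.

(** Both terms agree for s = 0 and s = 2. For s >= 3 the loss is of order z^(s-1), so a factor 1/q
    is gained; two powers of z/q are kept for the later summation over vertices, and the rest is
    absorbed by X. *)
Lemma scaled_ffact_le (d s : nat) (z q X : R) :
  0 <= z -> z ^+ 2 = d%:R * (d%:R - 1) -> 0 < q -> 1 <= X -> z / q <= X ->
  s != 1%N ->
  (z / q) ^+ s - (d ^_ s)%:R / q ^+ s <= q^-1 * (z / q) ^+ 2 * (8 * X) ^+ s.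
Proof.
move=> z0 hz q0 X1 zX s1.
have X0 : 0 <= X by exact: le_trans X1.
have x0 : 0 <= z / q by rewrite divr_ge0 // ltW.
have rhs0 : 0 <= q^-1 * (z / q) ^+ 2 * (8 * X) ^+ s.
  by rewrite !mulr_ge0 ?exprn_ge0 ?invr_ge0 ?(ltW q0) // mulr_ge0.
case: s s1 rhs0 => [|[|[|k]]] // _ rhs0.
- by rewrite !expr0 divr1 ffactn0 subrr.
- suff -> : (z / q) ^+ 2 - (d ^_ 2)%:R / q ^+ 2 = 0 by [].
  rewrite expr_div_n hz ffactnSr ffactn1 natrM.
  case: d hz => [|d] hz; first by rewrite !mul0r subrr.
  by rewrite subn1 /= -natr1 addrK subrr.
(* For d <= 1 one has z = 0, and the comparison d <= 2z used afterwards can fail. *)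
have [d1|d2] := leqP d 1.
  have /eqP : z ^+ 2 = 0.
    by rewrite hz; case: d d1 {hz} => [|[|]] // _; rewrite ?mul0r // subrr mulr0.
  rewrite sqrf_eq0 => /eqP z00; rewrite z00 in rhs0 *.
  rewrite [X in X ^+ _ - _]mul0r expr0n /= sub0r; apply: le_trans rhs0.
  by rewrite oppr_le0 divr_ge0 // exprn_ge0 // ltW.
have d2' : 2 <= d%:R :> R by rewrite ler_nat.
have zd : z <= d%:R.
  by rewrite -(ler_pXn2r (n := 2)) ?nnegrE // hz; nra.
have dz : d%:R <= 2 * z.
  by rewrite -(ler_pXn2r (n := 2)) ?nnegrE ?mulr_ge0 // exprMn hz; nra.
(* The 8 is 4 times 2: s^2 <= 4^s, and d^(s-1) <= 2^s z^(s-1) because d <= 2z. *)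
have step : z ^+ k.+3 - (d ^_ k.+3)%:R <= 8 ^+ k.+3 * z ^+ k.+2.
  apply: (@le_trans _ _ (d%:R ^+ k.+3 - (d ^_ k.+3)%:R)).
    by rewrite lerD2r lerXn2r ?nnegrE.
  apply: (le_trans (pow_sub_ffact_le _ _)).
  apply: (@le_trans _ _ (4 ^+ k.+3 * (2 ^+ k.+3 * z ^+ k.+2))).
    apply: ler_pM; rewrite ?sqr_ge0 ?exprn_ge0 //.
      rewrite (_ : 4 = 2 ^+ 2) -?exprM ?[(2 * _)%N]mulnC ?exprM; last by rewrite expr2; ring.
      by apply: lerXn2r; rewrite ?nnegrE ?exprn_ge0 // -natrX ler_nat ltnW // ltn_expl.
    apply: (@le_trans _ _ ((2 * z) ^+ k.+2)).
      by apply: lerXn2r; rewrite ?nnegrE ?mulr_ge0.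
    rewrite exprMn ler_wpM2r ?exprn_ge0 // ler_eXn2l // ltr1n //.
  rewrite mulrA -exprMn (_ : 4 * 2 = 8) //; ring.
have -> : (z / q) ^+ k.+3 - (d ^_ k.+3)%:R / q ^+ k.+3 =
    (z ^+ k.+3 - (d ^_ k.+3)%:R) / q ^+ k.+3 by rewrite expr_div_n mulrBl.
apply: (@le_trans _ _ (8 ^+ k.+3 * z ^+ k.+2 / q ^+ k.+3)).
  by rewrite ler_wpM2r // invr_ge0 exprn_ge0 // ltW.
have -> : 8 ^+ k.+3 * z ^+ k.+2 / q ^+ k.+3 =
    q^-1 * (z / q) ^+ 2 * (8 ^+ k.+3 * (z / q) ^+ k).
  rewrite !expr_div_n -[k.+3]addn3 -[k.+2]addn2 !exprD.
  have qk : q ^+ k != 0 by rewrite expf_neq0 // gt_eqF.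
  have q1 : q != 0 by rewrite gt_eqF.
  move: (8 ^+ k) (z ^+ k) (q ^+ k) qk => a b e e0.
  by field; rewrite q1 e0.
apply: ler_wpM2l; first by rewrite mulr_ge0 ?sqr_ge0 // invr_ge0 ltW.
rewrite [(8 * X) ^+ _]exprMn; apply: ler_wpM2l; first by rewrite exprn_ge0.
apply: (@le_trans _ _ (X ^+ k)); first by rewrite lerXn2r ?nnegrE.
by rewrite ler_weXn2l // -addn3 leq_addr.
Qed.

(** With r the quotient of (2N)^K by (2N-1)(2N-3)...(2N-2K+1), and F, G the scaled products of
    falling factorials and of powers, the difference is (r-1)F - (G-F). The two summands of the
    bound treat these two errors separately. *)
Lemma falling_product_close (I : finType) (d s : I -> nat) (z : I -> R)
    (q X : R) (N K : nat) :
  (0 < N)%N -> (\sum_i d i = 2 * N)%N -> (\sum_i s i = 2 * K)%N ->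
  (forall i, s i != 1%N) -> (forall i, 0 <= z i) ->
  (forall i, z i ^+ 2 = (d i)%:R * ((d i)%:R - 1)) ->
  0 < q -> q ^+ 2 = (2 * N)%:R -> 1 <= X -> (forall i, z i / q <= X) ->
  `|(\prod_i (d i) ^_ (s i))%:R * ((odd_factorial (N - K))%:R / (odd_factorial N)%:R)
    - \prod_i (z i / q) ^+ s i| <=
  ((2 * N)%:R)^-1 * \prod_i (8 * (z i / q)) ^+ s i
  + q^-1 * \sum_i (z i / q) ^+ 2 *
      \prod_j (if j == i then 8 * X else z j / q) ^+ s j.
Proof.
move=> N0 hd hs s1 z0 hz q0 hq X1 zX.
have x0 i : 0 <= z i / q by rewrite divr_ge0 // ltW.
have Q0 : 0 < (2 * N)%:R :> R by rewrite ltr0n; lia.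
pose f i : R := (d i ^_ s i)%:R / q ^+ s i.
pose g i : R := (z i / q) ^+ s i.
have fg i : 0 <= f i <= g i.
  rewrite /f /g divr_ge0 ?exprn_ge0 ?(ltW q0) //= expr_div_n ler_wpM2r //.
    by rewrite invr_ge0 exprn_ge0 // ltW.
  exact: ffact_le_pow.
have F0 : 0 <= \prod_i f i by apply: prodr_ge0 => i _; case/andP: (fg i).
have FG : \prod_i f i <= \prod_i g i by apply: ler_prod => i _; exact: fg.
have hF : (\prod_i (d i) ^_ (s i))%:R = (2 * N)%:R ^+ K * \prod_i f i :> R.
  rewrite -hq -exprM -hs -prodrXr -big_split natr_prod /=.
  apply: eq_bigr => i _; rewrite /f mulrCA divff ?mulr1 //.
  by rewrite expf_neq0 // gt_eqF.
have diff : \prod_i g i - \prod_i f i <= q^-1 * \sum_i (z i / q) ^+ 2 *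
      \prod_j (if j == i then 8 * X else z j / q) ^+ s j.
  have hb i := scaled_ffact_le (z0 i) (hz i) q0 X1 (zX i) (s1 i).
  apply: (le_trans (prodr_sub_le fg hb)).
  rewrite le_eqVlt; apply/orP; left; apply/eqP.
  rewrite big_distrr; apply: eq_bigr => i _ /=.
  rewrite (bigD1 i) //= eqxx [in RHS](bigD1 i) //= eqxx !mulrA; congr (_ * _).
  by apply: eq_bigr => j /negPf->.
have tail0 : 0 <= ((2 * N)%:R)^-1 * \prod_i (8 * (z i / q)) ^+ s i.
  rewrite mulr_ge0 ?invr_ge0 ?(ltW Q0) //; apply: prodr_ge0 => i _.
  by rewrite exprn_ge0 // mulr_ge0.
rewrite hF; set F := \prod_i f i in F0 FG diff *; set G := \prod_i g i in FG diff *.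
(* If K > N, more half-edges are demanded than exist, so F = 0 and only G remains to be bounded. *)
have [NK|KN] := ltnP N K.
  have F00 : F = 0.
    have [i di] : exists i, (d i < s i)%N.
      apply/existsP; apply: contraTT NK => /existsPn h; rewrite -leqNgt.
      rewrite -(leq_pmul2l (m := 2)) // -hd -hs; apply: leq_sum => i _.
      by rewrite leqNgt.
    by rewrite /F (bigD1 i) //= /f ffact_small // mul0r mul0r.
  rewrite F00 mulr0 mul0r sub0r normrN ger0_norm ?(le_trans F0) //.
  by move: diff; rewrite F00 subr0 => diff; rewrite -[leLHS]add0r; exact: lerD.
set o := (odd_factorial (N - K))%:R; set o' := (odd_factorial N)%:R.
have o0 : 0 < o :> R by rewrite ltr0n odd_factorial_gt0.
have o'0 : 0 < o' :> R by rewrite ltr0n odd_factorial_gt0.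
set r := (2 * N)%:R ^+ K * (o / o').
have r1 : 1 <= r.
  rewrite /r mulrA ler_pdivlMr // mul1r -natrX -natrM ler_nat.
  exact: odd_factorial_upper.
have r8 : r <= 8 ^+ K.
  rewrite /r mulrA ler_pdivrMr // -!natrX -!natrM ler_nat.
  exact: odd_factorial_ratio_le.
have rK : r - 1 <= r * (K%:R ^+ 2 / (2 * N)%:R).
  have := odd_factorial_lower KN N0; rewrite -/o -/o' => h.
  have : r * (1 - K%:R ^+ 2 / (2 * N)%:R) <= 1.
    rewrite /r mulrA mulrAC ler_pdivrMr // mul1r mulrAC; exact: h.
  by rewrite mulrBr mulr1; lra.
(* Since r <= 8^K and K^2 <= 4^K, the base 32 would do; 64 = 8^2 is used because the s_i add up to
   2K, so that the constant distributes as 8^(s_i). *)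
have rho : r - 1 <= (2 * N)%:R^-1 * 64 ^+ K.
  apply: (le_trans rK); rewrite mulrA mulrC ler_wpM2l ?invr_ge0 ?(ltW Q0) //.
  rewrite (_ : 64 = 8 * (2 * 2) ^+ 1 * 2); last by ring.
  apply: (@le_trans _ _ (8 ^+ K * (2 ^+ K * 2 ^+ K))).
    apply: ler_pM; rewrite ?sqr_ge0 ?(le_trans _ r1) // expr2.
    by apply: ler_pM => //; rewrite -natrX ler_nat ltnW // ltn_expl.
  rewrite -!exprMn; apply: lerXn2r; rewrite ?nnegrE //; lra.
have -> : (2 * N)%:R ^+ K * F * (o / o') = r * F by rewrite /r; ring.
have -> : r * F - \prod_i (z i / q) ^+ s i = (r - 1) * F - (G - F).
  by rewrite /G /g; ring.
apply: (le_trans (ler_normB _ _)); rewrite !ger0_norm ?subr_ge0 //; last first.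
  by rewrite mulr_ge0 // subr_ge0.
apply: lerD => //.
have -> : \prod_i (8 * (z i / q)) ^+ s i = 64 ^+ K * G.
  rewrite (_ : 64 = 8 ^+ 2); last by rewrite expr2; ring.
  rewrite -exprM -hs -prodrXr -big_split /=.
  by apply: eq_bigr => i _; rewrite exprMn.
rewrite mulrA; apply: ler_pM => //; by rewrite subr_ge0.
Qed.

End Estimates.

(** * Expansion of the probability *)

Section Expansion.
Local Open Scope ring_scope.
Variable R : realFieldType.

Lemma sum_alternating_bin (X D : nat) : (X <= D)%N ->
  \sum_(k < D.+1) (-1) ^+ k * 'C(X, k)%:R = (X == 0%N)%:R :> R.
Proof.
move=> XD; have := exprDn (1 : R) (-1) X; rewrite subrr expr0n => ->.
rewrite -(big_mkord xpredT (fun k => (-1) ^+ k * 'C(X, k)%:R)).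
rewrite -(big_mkord xpredT (fun k => (1 ^+ (X - k) * (-1) ^+ k) *+ 'C(X, k))).
rewrite (big_cat_nat (n := X.+1)) //= [X in _ + X]big_nat [Y in _ + Y]big1 ?addr0; last first.
  move=> k /andP[Xk _]; rewrite bin_small ?mulr0 //; lia.
by apply: eq_bigr => k _; rewrite expr1n mul1r mulr_natr.
Qed.

Variable n : nat.
Implicit Types (t : vertex_pair n) (i j : 'I_n) (x y : 'I_n -> R).

(* [coef t k] is the coefficient of ['C(X, k)] in the indicator that the number
   [X] of edges joining the ends of [t] is at most 0 (loop) or 1 (non-loop). *)
Definition coef t (k : nat) : R := (-1) ^+ k * (if is_loop t then 1 else 1 - k%:R).

(** At a non-loop, k C(X,k) = X C(X-1,k-1) turns the second part of the series into X times the
    indicator of X-1 = 0, which adds the case X = 1 to the indicator of X = 0. *)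
Lemma sum_coef_bin t (X D : nat) : (X <= D)%N ->
  \sum_(k < D.+1) coef t k * 'C(X, k)%:R = (X <= ~~ is_loop t)%N%:R.
Proof.
move=> XD; rewrite /coef; case: (is_loop t) => /=.
  by rewrite leqn0 -(sum_alternating_bin XD); apply: eq_bigr => k _; rewrite mulr1.
transitivity (\sum_(k < D.+1) (-1) ^+ k * 'C(X, k)%:R
   - \sum_(k < D.+1) (-1) ^+ k * (k%:R * 'C(X, k)%:R) : R).
  by rewrite -sumrB; apply: eq_bigr => k _; ring.
rewrite sum_alternating_bin // big_ord_recl /= mul0r mulr0 add0r.
case: D XD => [|D] XD.
  by rewrite big_ord0 subr0; case: X XD.
transitivity ((X == 0%N)%:R + X%:R * (X.-1 == 0%N)%:R : R); last first.
  by case: X XD => [|[|X]] _ /=; rewrite ?mul0r ?mulr0 ?addr0 ?add0r ?mulr1.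
congr (_ + _); rewrite -(sum_alternating_bin (D := D)); last by lia.
rewrite big_distrr -sumrN; apply: eq_bigr => k _ /=.
rewrite -natrM /bump /= add1n -mul_bin_diag exprS natrM; ring.
Qed.

Definition weight t (k : nat) : R := coef t k / (symmetry_factor t ^ k * k`!)%:R.

(** The Poisson side: each factor is a partial sum of the series for one pair, with mean
    [x i * x j], halved at loops. Truncation keeps the expansion over all [m] finite. *)
Definition truncated_product D x : R :=
  \prod_t \sum_(k < D.+1) weight t k * (x (fst_end t) * x (snd_end t)) ^+ k.

Definition majorant D x : R :=
  \prod_t \sum_(k < D.+1) `|weight t k| * (x (fst_end t) * x (snd_end t)) ^+ k.

Lemma prod_ends_exp x t : x (fst_end t) * x (snd_end t) = \prod_i x i ^+ incidence t i.
Proof.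
rewrite /incidence; under eq_bigr do rewrite exprD.
rewrite big_split /=; congr (_ * _).
  rewrite (bigD1 (fst_end t)) //= eqxx big1 ?mulr1 // => i.
  by rewrite eq_sym => /negPf->.
rewrite (bigD1 (snd_end t)) //= eqxx big1 ?mulr1 // => i.
by rewrite eq_sym => /negPf->.
Qed.

Lemma prod_monomials x (m : vertex_pair n -> nat) :
  \prod_t (x (fst_end t) * x (snd_end t)) ^+ m t = \prod_i x i ^+ vertex_degree m i.
Proof.
under eq_bigr do rewrite prod_ends_exp -prodrXl.
rewrite exchange_big /=; apply: eq_bigr => i _.
by rewrite /vertex_degree -prodrXr; apply: eq_bigr => t _; rewrite -exprM mulnC.
Qed.

Lemma prod_series_expand D (w : vertex_pair n -> nat -> R) x :
  \prod_t \sum_(k < D.+1) w t k * (x (fst_end t) * x (snd_end t)) ^+ k =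
  \sum_(m : {ffun vertex_pair n -> 'I_D.+1})
    (\prod_t w t (m t)) * \prod_i x i ^+ vertex_degree (fun t => m t) i.
Proof.
rewrite bigA_distr_bigA; apply: eq_bigr => m _.
by rewrite big_split /= (prod_monomials x (fun t => m t)).
Qed.

Lemma truncated_product_expand D x : truncated_product D x =
  \sum_(m : {ffun vertex_pair n -> 'I_D.+1})
    (\prod_t weight t (m t)) * \prod_i x i ^+ vertex_degree (fun t => m t) i.
Proof. exact: prod_series_expand. Qed.

Lemma majorant_expand D x : majorant D x =
  \sum_(m : {ffun vertex_pair n -> 'I_D.+1})
    (\prod_t `|weight t (m t)|) * \prod_i x i ^+ vertex_degree (fun t => m t) i.
Proof. exact: (prod_series_expand _ (fun t k => `|weight t k|)). Qed.

Lemma sum_vertex_degree (m : vertex_pair n -> nat) :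
  (\sum_i vertex_degree m i = 2 * \sum_t m t)%N.
Proof.
rewrite /vertex_degree exchange_big big_distrr /=; apply: eq_bigr => t _.
by rewrite -big_distrr /= sum_incidence mulnC.
Qed.

(* Vertex degree one would come from a non-loop of multiplicity one, and
   [coef t 1 = 0] for non-loops. *)
Lemma vertex_degree_neq1 (m : vertex_pair n -> nat) i :
  \prod_t weight t (m t) != 0 -> vertex_degree m i != 1%N.
Proof.
apply: contraNneq => hm.
have [t ht] : exists t, (0 < m t * incidence t i)%N.
  apply/existsP; move/eqP: hm; apply: contraTT => /existsPn h.
  by rewrite /vertex_degree big1 // => t _; apply/eqP; rewrite -leqn0 leqNgt.
have : (m t * incidence t i = 1)%N.
  apply/eqP; rewrite eqn_leq ht andbT -hm /vertex_degree (bigD1 t) //=.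
  exact: leq_addr.
move/eqP; rewrite muln_eq1 => /andP[/eqP mt /eqP it].
rewrite (bigD1 t) //= mt /weight /coef; case: ifP => lt.
  by move: it; rewrite /incidence -(eqP lt); case: (_ == i).
by rewrite subrr mulr0 !mul0r.
Qed.

Variables (H : finType) (c : H -> 'I_n).
Implicit Type (A : {set H}).

Definition simple_matchings A : nat :=
  \sum_(P in matchings A) \prod_t (multiplicity c t P <= ~~ is_loop t).

Lemma multiplicity_le t P A N : #|A| = (2 * N)%N -> P \in matchings A ->
  (multiplicity c t P <= N)%N.
Proof.
move=> hA hP; rewrite -(card_matching hA hP) -sum1_card; apply: leq_sum => e _.
by case: (joins _ _ _).
Qed.

(** Each indicator is replaced by its series, which is exact because no multiplicity exceeds N <= D;
    the product is expanded and every term is a joint factorial moment. *)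
Lemma simple_matchings_expand A N D : #|A| = (2 * N)%N -> (N <= D)%N ->
  (simple_matchings A)%:R / (odd_factorial N)%:R =
  \sum_(m : {ffun vertex_pair n -> 'I_D.+1})
    (\prod_t weight t (m t)) *
    ((\prod_i (degree c A i) ^_ (vertex_degree (fun t => m t) i))%:R *
     ((odd_factorial (N - \sum_t m t))%:R / (odd_factorial N)%:R)).
Proof.
move=> hA ND.
have -> : (simple_matchings A)%:R = \sum_(m : {ffun vertex_pair n -> 'I_D.+1})
    (\prod_t coef t (m t)) *
      \sum_(P in matchings A) \prod_t 'C(multiplicity c t P, m t)%:R :> R.
  under [RHS]eq_bigr do rewrite big_distrr /=.
  rewrite exchange_big natr_sum /=; apply: eq_bigr => P hP.
  rewrite natr_prod; under eq_bigr => t _.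
    rewrite -(@sum_coef_bin t _ D); last first.
      exact: leq_trans (multiplicity_le t hA hP) ND.
    over.
  rewrite bigA_distr_bigA; apply: eq_bigr => m _.
  by rewrite big_split.
rewrite mulr_suml; apply: eq_bigr => m _.
have hm := @sum_matchings_ffact H n c A N (fun t => m t) hA.
set F := (\prod_(t : vertex_pair n) (symmetry_factor t ^ m t * (m t)`!))%N.
have F0 : F%:R != 0 :> R.
  by rewrite pnatr_eq0 -lt0n prodn_gt0 // => t; rewrite muln_gt0 fact_gt0 expn_gt0.
have hB : (\sum_(P in matchings A) \prod_t 'C(multiplicity c t P, m t)%:R) * F%:R =
   (\prod_i (degree c A i) ^_ (vertex_degree (fun t => m t) i))%:R *
     (odd_factorial (N - \sum_t m t))%:R :> R.
  rewrite -natrM -hm [in RHS]natrM natr_sum.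
  rewrite /F big_split /= natrM [X in _ * X]mulrC mulrA; congr (_ * _).
  rewrite mulr_suml; apply: eq_bigr => P _; rewrite -!natr_prod -natrM.
  by rewrite -big_split /=; congr (_%:R); apply: eq_bigr => t _; rewrite bin_ffact.
rewrite mulrA -hB [X in _ = X * _]big_split /= prodfV -natr_prod -/F.
by field; rewrite F0 pnatr_eq0 -lt0n odd_factorial_gt0.
Qed.

Lemma simple_matchings_close A N D (z : 'I_n -> R) (q X : R) :
  (0 < N)%N -> #|A| = (2 * N)%N -> (N <= D)%N ->
  (forall i, 0 <= z i) ->
  (forall i, z i ^+ 2 = (degree c A i)%:R * ((degree c A i)%:R - 1)) ->
  0 < q -> q ^+ 2 = (2 * N)%:R -> 1 <= X -> (forall i, z i / q <= X) ->
  `|(simple_matchings A)%:R / (odd_factorial N)%:R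
    - truncated_product D (fun i => z i / q)| <=
  ((2 * N)%:R)^-1 * majorant D (fun i => 8 * (z i / q))
  + q^-1 * \sum_i (z i / q) ^+ 2 *
      majorant D (fun j => if j == i then 8 * X else z j / q).
Proof.
move=> N0 hA ND z0 hz q0 hq X1 zX.
rewrite (simple_matchings_expand hA ND) truncated_product_expand majorant_expand.
rewrite -sumrB [Y in _ <= Y + _]big_distrr /=.
under [Y in _ <= _ + _ * Y]eq_bigr do rewrite majorant_expand big_distrr /=.
rewrite [Y in _ <= _ + _ * Y]exchange_big [Y in _ <= _ + Y]big_distrr -big_split /=.
apply: (le_trans (ler_norm_sum _ _ _)); apply: ler_sum => m _.
rewrite -mulrBr normrM normr_prod.
set W := \prod_t `|_|; have W0 : 0 <= W by apply: prodr_ge0.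
(* Terms of weight zero vanish on both sides; the others have no vertex of degree one, as the
   termwise comparison requires. *)
have [Wz|Wnz] := eqVneq (\prod_t weight t (m t)) 0.
  have -> : W = 0 by rewrite /W -normr_prod Wz normr0.
  rewrite !mul0r mulr0 add0r big1 ?mulr0 // => i _; by rewrite mul0r mulr0.
have := falling_product_close N0 _ (sum_vertex_degree (fun t => m t))
  (fun i => vertex_degree_neq1 i Wnz) z0 hz q0 hq X1 zX.
rewrite sum_degree => /(_ hA)/(ler_wpM2l W0)/le_trans; apply.
rewrite mulrDr mulrCA lerD2l mulrCA ler_wpM2l ?invr_ge0 ?(ltW q0) //.
by rewrite big_distrr /=; apply: ler_sum => i _; rewrite mulrCA.
Qed.

End Expansion.

From mathcomp Require Import all_classical all_reals all_analysis.
Import numFieldNormedType.Exports.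
Local Open Scope classical_set_scope.
Local Open Scope ring_scope.

(** * Majorant and limit of the truncated products *)

Section Analysis.
Variable R : realType.

Lemma expR_partial_sum (y : R) D :
  \sum_(k < D) y ^+ k / k`!%:R = series (exp_coeff y) D.
Proof. by rewrite /series /= big_mkord; apply: eq_bigr. Qed.

Lemma expR_partial_sum_le (y : R) D : 0 <= y -> \sum_(k < D) y ^+ k / k`!%:R <= expR y.
Proof.
move=> y0; rewrite expR_partial_sum; apply: nondecreasing_cvgn_le.
  by apply: nondecreasing_series => k _ _; exact: exp_coeff_ge0.
exact: is_cvg_series_exp_coeff.
Qed.

Lemma cvg_expR_partial_sum (y : R) :
  (fun D => \sum_(k < D) y ^+ k / k`!%:R) @ \oo --> expR y.
Proof. under eq_fun do rewrite expR_partial_sum; exact: is_cvg_series_exp_coeff. Qed.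

Variable n : nat.
Implicit Types (t : vertex_pair n) (x : 'I_n -> R).

Lemma weight_loop t k (y : R) : is_loop t ->
  weight R t k * y ^+ k = (- (y / 2)) ^+ k / k`!%:R.
Proof.
move=> lt; rewrite /weight /coef /symmetry_factor lt mulr1 natrM natrX.
rewrite -[- (y / 2)]mulN1r !exprMn exprVn.
by field; rewrite expf_neq0 ?pnatr_eq0 // -lt0n fact_gt0.
Qed.

Lemma weight_edge t k (y : R) : ~~ is_loop t ->
  weight R t k * y ^+ k = (1 - k%:R) * ((- y) ^+ k / k`!%:R).
Proof.
move=> /negPf lt; rewrite /weight /coef /symmetry_factor lt exp1n mul1n.
by rewrite [in RHS]exprNn; ring.
Qed.

(** The coefficient 1 - k splits the series in two: the constant part gives e^(-y), and -k shifts
    the index by one and gives y e^(-y). *)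
Lemma cvg_weight_edge t (y : R) : ~~ is_loop t ->
  (fun D => \sum_(k < D.+1) weight R t k * y ^+ k) @ \oo --> (1 + y) * expR (- y).
Proof.
move=> lt.
have -> : (fun D => \sum_(k < D.+1) weight R t k * y ^+ k) =
   (fun D => \sum_(k < D.+1) (- y) ^+ k / k`!%:R) \+
   (fun D => y * \sum_(k < D) (- y) ^+ k / k`!%:R).
  apply/funext => D /=.
  transitivity (\sum_(k < D.+1) (- y) ^+ k / k`!%:R
     - \sum_(k < D.+1) k%:R * ((- y) ^+ k / k`!%:R)).
    rewrite -sumrB; apply: eq_bigr => k _; rewrite weight_edge //; ring.
  congr (_ + _); rewrite big_ord_recl mul0r add0r mulr_sumr -sumrN.
  apply: eq_bigr => k _; rewrite lift0 factS exprS natrM.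
  by field; rewrite addrC natr1 !pnatr_eq0 -!lt0n fact_gt0.
rewrite mulrDl mul1r; apply: cvgD.
  rewrite (cvg_shiftS (fun D => \sum_(k < D) (- y) ^+ k / k`!%:R)).
  exact: cvg_expR_partial_sum.
by apply: cvgMr; exact: cvg_expR_partial_sum.
Qed.

(** The probability that a Poisson variable is 0 (loop, mean y/2) or at most 1 (non-loop, mean
    y). *)
Definition limit_factor t (y : R) : R :=
  if is_loop t then expR (- (y / 2)) else (1 + y) * expR (- y).

Lemma cvg_truncated_product x :
  (fun D => truncated_product D x) @ \oo -->
    \prod_t limit_factor t (x (fst_end t) * x (snd_end t)).
Proof.
apply: cvg_big => [|t _]; first exact: mul_continuous.
rewrite /limit_factor; move: (x _ * x _) => y; case: ifPn => lt; last exact: cvg_weight_edge.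
have -> : (fun D => \sum_(k < D.+1) weight R t k * y ^+ k) =
    (fun D => \sum_(k < D.+1) (- (y / 2)) ^+ k / k`!%:R).
  by apply/funext => D; apply: eq_bigr => k _; exact: weight_loop.
rewrite (cvg_shiftS (fun D => \sum_(k < D) (- (y / 2)) ^+ k / k`!%:R)).
exact: cvg_expR_partial_sum.
Qed.

(** The linear coefficient vanishes, so the excess over 1 is quadratic in y. This keeps the product
    over all pairs bounded in terms of S alone. *)
Lemma majorant_edge_le t (y : R) D : ~~ is_loop t -> 0 <= y ->
  \sum_(k < D.+1) `|weight R t k| * y ^+ k <= expR (y ^+ 2 * expR y).
Proof.
move=> lt y0.
apply: (@le_trans _ _ (1 + y ^+ 2 * expR y)); last exact: expR_ge1Dx.
have nw k : `|weight R t k| * y ^+ k = `|1 - k%:R| * (y ^+ k / k`!%:R).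
  rewrite -[y ^+ k in LHS]ger0_norm ?exprn_ge0 // -normrM weight_edge // normrM.
  by rewrite normrM normrX normrN normfV (ger0_norm y0) (ger0_norm (ler0n R k`!)).
rewrite big_ord_recl nw /= subr0 normr1 expr0 divr1 mulr1 lerD2l.
case: D => [|D]; first by rewrite big_ord0 mulr_ge0 ?sqr_ge0 ?expR_ge0.
rewrite big_ord_recl nw /= subrr normr0 mul0r add0r.
apply: le_trans (ler_wpM2l (sqr_ge0 y) (@expR_partial_sum_le y D y0)).
rewrite mulr_sumr; apply: ler_sum => k _.
rewrite nw /bump /= ?add1n.
have -> : `|1 - k.+2%:R| = k.+1%:R :> R.
  by rewrite -[k.+2%:R]natr1 opprD addrCA subrr addr0 normrN ger0_norm.
have k0 : 0 < k`!%:R :> R by rewrite ltr0n fact_gt0.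
have -> : k.+1%:R * (y ^+ k.+2 / k.+2`!%:R) = y ^+ 2 * (y ^+ k / k`!%:R) * k.+2%:R^-1.
  rewrite !factS !natrM -addn2 exprD; field.
  by have k1 := ler0n R k; rewrite (gt_eqF k0) !gt_eqF //; lra.
by rewrite ler_piMr ?invf_le1 ?ler1n ?ltr0n // mulr_ge0 ?sqr_ge0 // divr_ge0 ?exprn_ge0.
Qed.

Lemma majorant_loop_le t (y : R) D : is_loop t -> 0 <= y ->
  \sum_(k < D.+1) `|weight R t k| * y ^+ k <= expR (y / 2).
Proof.
move=> lt y0; apply: le_trans (expR_partial_sum_le D.+1 (divr_ge0 y0 (ler0n R 2))).
apply: ler_sum => k _.
rewrite -[y ^+ k in leLHS]ger0_norm ?exprn_ge0 // -normrM weight_loop //.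
rewrite normrM normrX normrN normfV !ger0_norm //; exact: divr_ge0.
Qed.

Definition majorant_bound (S : R) : R := expR (S / 2 + S ^+ 2 * expR S).

Lemma majorant_bound_le (S T : R) : 0 <= S -> S <= T ->
  majorant_bound S <= majorant_bound T.
Proof.
move=> S0 ST; rewrite ler_expR lerD //; first by rewrite ler_pM2r // invr_gt0.
by apply: ler_pM; rewrite ?sqr_ge0 ?expR_ge0 ?ler_expR // lerXn2r ?nnegrE ?(le_trans S0).
Qed.

(** Loops contribute S/2 to the exponent. A non-loop contributes at most x_i^2 x_j^2 e^S, as x_i x_j
    <= x_i^2 + x_j^2 <= S, and these add up to at most S^2 e^S. The bound depends neither on D nor
    on n. *)
Lemma majorant_le D x : (forall i, 0 <= x i) ->
  majorant D x <= majorant_bound (\sum_i x i ^+ 2).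
Proof.
move=> x0; set S := \sum_i _.
have S0 : 0 <= S by apply: sumr_ge0 => i _; exact: sqr_ge0.
pose e (i j : 'I_n) := if i == j then x i ^+ 2 / 2 else x i ^+ 2 * x j ^+ 2 * expR S.
apply: (@le_trans _ _ (\prod_(t : vertex_pair n) expR (e (fst_end t) (snd_end t)))).
  apply: ler_prod => t _; apply/andP; split.
    by apply: sumr_ge0 => k _; rewrite mulr_ge0 ?exprn_ge0 ?mulr_ge0.
  rewrite /e; case: ifPn => lt.
    by rewrite (eqP lt) -expr2; apply: majorant_loop_le; rewrite ?sqr_ge0.
  have y0 : 0 <= x (fst_end t) * x (snd_end t) by exact: mulr_ge0.
  apply: le_trans (majorant_edge_le D lt y0) _.
  rewrite ler_expR -exprMn ler_wpM2l ?sqr_ge0 // ler_expR.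
  apply: (@le_trans _ _ (x (fst_end t) ^+ 2 + x (snd_end t) ^+ 2)).
    by have := sqr_ge0 (x (fst_end t) - x (snd_end t)); nra.
  rewrite /S (bigD1 (fst_end t)) //= (bigD1 (snd_end t)) 1?eq_sym //= lerD2l lerDl.
  by apply: sumr_ge0 => i _; exact: sqr_ge0.
rewrite -expR_sum ler_expR (big_vertex_pair _ e) big_split /=.
apply: lerD.
  by rewrite mulr_suml; apply: ler_sum => i _; rewrite /e eqxx.
apply: (@le_trans _ _ (\sum_i \sum_j x i ^+ 2 * x j ^+ 2 * expR S)).
  apply: ler_sum => i _; rewrite [leRHS](bigID (fun j : 'I_n => (i < j)%N)) /=.
  apply: (@le_trans _ _ (\sum_(j < n | (i < j)%N) x i ^+ 2 * x j ^+ 2 * expR S)).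
    by apply: ler_sum => j ij; rewrite /e -val_eqE /= (ltn_eqF ij).
  rewrite lerDl; apply: sumr_ge0 => j _.
  by rewrite !mulr_ge0 ?sqr_ge0 ?expR_ge0.
under eq_bigr do rewrite -mulr_suml -mulr_sumr.
by rewrite -mulr_suml -mulr_suml expr2.
Qed.

End Analysis.

(** * Many loops *)

Section SecondMoment.
Variables (R : realType) (H : finType) (n : nat) (c : H -> 'I_n).
Implicit Types (A : {set H}) (P : {set {set H}}).

Lemma loopsE P : loops c P = (\sum_(t : vertex_pair n | is_loop t) multiplicity c t P)%N.
Proof. exact: exchange_big. Qed.

(** Chebyshev's inequality: a simple matching has no loop, so it deviates from the mean number of
    loops by the whole mean. *)
Lemma simple_matchings_second_moment A M (S : R) : #|A| = (2 * M.+2)%N -> 0 < S ->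
  \sum_i (degree c A i)%:R * ((degree c A i)%:R - 1) = (2 * M.+2)%:R * S ->
  (simple_matchings c A)%:R / (odd_factorial M.+2)%:R <= 2 / S + 2 / (2 * M).+1%:R.
Proof.
move=> hA S0 hS.
set m : R := M%:R; have m0 : 0 <= m by [].
set o : R := (odd_factorial M)%:R.
have o0 : 0 < o by rewrite ltr0n odd_factorial_gt0.
have hF1 : (odd_factorial M.+1)%:R = (2 * m + 1) * o.
  by rewrite odd_factorialS natrM -natr1 natrM.
have hF : (odd_factorial M.+2)%:R = (2 * m + 3) * (2 * m + 1) * o.
  rewrite odd_factorialS natrM hF1 -natr1 natrM -natr1 -/m; ring.
set b : R := (potential_loops c A)%:R.
have hb : b = (m + 2) * S.
  have : 2 * b = (2 * M.+2)%:R * S.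
    rewrite -hS -natrM potential_loopsE natr_sum; apply: eq_bigr => i _.
    case: (degree c A i) => [|k]; first by rewrite mul0r.
    by rewrite ffactnSr ffactn1 natrM subn1 /= -natr1 addrK.
  rewrite natrM -!natr1 -/m; lra.
have h1 : \sum_(P in matchings A) (loops c P)%:R = b * (2 * m + 1) * o.
  by rewrite -natr_sum (sum_loops c hA) natrM hF1 mulrA.
have h2 : \sum_(P in matchings A) (loops c P)%:R ^+ 2 <= b * (2 * m + 1) * o + b ^+ 2 * o.
  under eq_bigr do rewrite -natrX.
  rewrite -natr_sum -mulrA -hF1 -natrX -!natrM -natrD ler_nat.
  exact: sum_sqr_loops.
(* The expected number of loops: each potential loop is present with probability 1/(2N-1), where N =
   M+2. *)
pose u := b / (2 * m + 3).
have bu : b = u * (2 * m + 3) by rewrite /u divfK // gt_eqF //; lra.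
have u0 : S / 2 <= u.
  by rewrite /u hb ler_pdivlMr; nra.
have chebyshev : (simple_matchings c A)%:R * u ^+ 2 <=
    \sum_(P in matchings A) ((loops c P)%:R - u) ^+ 2.
  rewrite /simple_matchings natr_sum mulr_suml; apply: ler_sum => P _.
  have [/forallP h|] := boolP [forall t, multiplicity c t P <= ~~ is_loop t]%N.
    rewrite big1 => [|t _]; last by rewrite h.
    rewrite loopsE big1 ?sub0r ?sqrrN ?mul1r // => t lt.
    by apply/eqP; have := h t; rewrite lt leqn0.
  case/forallPn=> t /negPf ht; rewrite (bigD1 t) //= ht mul0n mul0r; exact: sqr_ge0.
have expand : \sum_(P in matchings A) ((loops c P)%:R - u) ^+ 2 =
    \sum_(P in matchings A) (loops c P)%:R ^+ 2 - 2 * u * (b * (2 * m + 1) * o)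
    + u ^+ 2 * ((2 * m + 3) * (2 * m + 1) * o).
  rewrite -h1 -hF -(card_matchings hA) mulr_natr -sumr_const mulr_sumr -sumrB.
  by rewrite -big_split; apply: eq_bigr => P _ /=; ring.
have up : 0 < u by apply: lt_le_trans u0; rewrite divr_gt0.
have u2 : 0 < u ^+ 2 by rewrite exprn_gt0.
have F0 : 0 < (2 * m + 3) * (2 * m + 1) * o by rewrite !mulr_gt0 //; lra.
have bound : (simple_matchings c A)%:R <= (2 * m + 3) * (2 * m + 1) * o / u + 2 * (2 * m + 3) * o.
  rewrite -(ler_pM2r u2); apply: (le_trans chebyshev).
  rewrite expand; apply: (@le_trans _ _ (b * (2 * m + 1) * o + b ^+ 2 * o
     - 2 * u * (b * (2 * m + 1) * o) + u ^+ 2 * ((2 * m + 3) * (2 * m + 1) * o))).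
    by rewrite lerD2r lerD2r.
  rewrite bu -subr_ge0 (_ : _ - _ = 0) //; field; exact: lt0r_neq0.
rewrite hF -[(2 * M).+1%:R]natr1 natrM -/m.
apply: (@le_trans _ _ (u^-1 + 2 / (2 * m + 1))).
  rewrite ler_pdivrMr //; apply: (le_trans bound).
  rewrite -subr_ge0 (_ : _ - _ = 0) //; field.
  by rewrite !gt_eqF //; lra.
rewrite lerD2r (_ : 2 / S = (S / 2)^-1); last by rewrite invf_div.
by rewrite lef_pV2 ?posrE //; exact: divr_gt0.
Qed.

End SecondMoment.

(** * The configuration model *)

Section ConfigurationModel.
Variables (R : realType) (n : nat) (d : 'I_n -> nat).

Let vertex (x : half_edge d) : 'I_n := tag x.

Lemma degree_half_edges i : degree vertex [set: half_edge d]%SET i = d i.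
Proof.
rewrite /degree -[RHS]card_ord.
rewrite -(card_imset predT (f := fun k : 'I_(d i) => Tagged (fun v => 'I_(d v)) k)).
  apply: eq_card => -[v k]; rewrite !inE /=.
  apply/eqP/imsetP => [vi|[k' _ h]]; last exact: (congr1 vertex h).
  by rewrite /vertex /= in vi; subst i; exists k.
by move=> k k' /eqP; rewrite eq_Tagged => /eqP.
Qed.

Lemma card_half_edges : #|[set: half_edge d]%SET| = (\sum_i d i)%N.
Proof. by rewrite -(sum_degree vertex); apply: eq_bigr => i _; rewrite degree_half_edges. Qed.

Lemma card_edges_between (c : configuration d) (t : vertex_pair n) :
  #|edges_between c (fst_end t) (snd_end t)| = multiplicity vertex t (val c).
Proof.
have hc : val c \in matchings [set: half_edge d]%SET by rewrite inE; exact: valP c.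
rewrite /multiplicity -sum1_card big_mkcond [RHS]big_mkcond /=.
apply: eq_bigr => p _; rewrite inE; case: (boolP (p \in val c)) => //= pc.
rewrite -[LHS]/(nat_of_bool [exists x, exists y,
  [&& p == [set x; y]%SET, tag x == fst_end t & tag y == snd_end t]]).
congr nat_of_bool; apply/existsP/joins_endsP.
  case=> x /existsP[y /and3P[/eqP hp /eqP hx /eqP hy]]; exists x, y; split=> //.
  by have /matchingsP[_ /(_ p pc)] := hc; rewrite hp cards2; case: eqP.
case=> x [y [_ -> hx hy]]; exists x; apply/existsP; exists y.
by rewrite eqxx -hx -hy !eqxx.
Qed.

Lemma simple_multigraphE (c : configuration d) :
  simple_multigraph (config_multigraph c) =
  [forall t, multiplicity vertex t (val c) <= ~~ is_loop t]%N.
Proof.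
apply/andP/forallP => [[/forallP h1 /forallP h2] t|h].
  rewrite -card_edges_between; case: (boolP (is_loop t)) => [/eqP <-|_].
    by have := h1 (fst_end t); rewrite /= leqn0.
  by have /forallP/(_ (snd_end t)) := h2 (fst_end t).
have hle (v w : 'I_n) (vw : (v <= w)%N) : (#|edges_between c v w| <= (v != w))%N.
  by have := h (exist _ (v, w) vw); rewrite -card_edges_between.
split; apply/forallP => v; first by have := hle v v (leqnn _); rewrite eqxx leqn0.
apply/forallP => w /=; case/orP: (leq_total v w) => vw.
  exact: leq_trans (hle _ _ vw) (leq_b1 _).
rewrite edges_betweenC; exact: leq_trans (hle _ _ vw) (leq_b1 _).
Qed.

Lemma prob_simpleE N : (\sum_i d i = 2 * N)%N ->
  prob_simple R d =
  (simple_matchings vertex [set: half_edge d]%SET)%:R / (odd_factorial N)%:R.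
Proof.
move=> hd; have hA : #|[set: half_edge d]%SET| = (2 * N)%N by rewrite card_half_edges.
rewrite /prob_simple /uniform_prob.
have big_conf (F : {set {set half_edge d}} -> nat) :
    (\sum_(c : configuration d) F (val c) =
     \sum_(P in matchings [set: half_edge d]%SET) F P)%N.
  symmetry; rewrite (reindex_omap (val : configuration d -> _) insub) /=.
    apply: eq_bigl => c; rewrite valK eqxx andbT.
    by rewrite inE; exact: valP c.
  by move=> P; rewrite inE => hP; rewrite insubT.
congr (_%:R / _%:R).
  rewrite /simple_matchings -(big_conf (fun P => \prod_t (multiplicity vertex t P <= ~~ is_loop t))%N).
  rewrite -sum1_card big_mkcond /=; apply: eq_bigr => c _.
  rewrite -[c \in _]/(simple_multigraph (config_multigraph c)) simple_multigraphE.
  case: forallP => [h|/forallP/forallPn[t /negPf ht]].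
    by rewrite big1 // => t _; rewrite h.
  by rewrite (bigD1 t) //= ht.
by rewrite -(card_matchings hA) -[RHS]sum1_card -big_conf sum1_card.
Qed.

Hypothesis even_sum : ~~ odd (\sum_i d i).
Let N := num_edges d.

Lemma sum_degrees : (\sum_i d i = 2 * N)%N.
Proof. by rewrite mul2n /N /num_edges even_halfK. Qed.

Definition root_weight i : R := Num.sqrt ((d i)%:R * ((d i)%:R - 1)).
(** The point x at which the products are evaluated: [lambda] factors as x_i x_j, and the squares
    x_i^2 add up to S. *)
Definition scaled_weight i : R := root_weight i / Num.sqrt (2 * N)%:R.

Lemma natr_pred_ge0 k : 0 <= k%:R * (k%:R - 1) :> R.
Proof.
case: k => [|k]; first by rewrite mul0r.
by rewrite mulr_ge0 // subr_ge0 ler1n.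
Qed.

Lemma sqr_root_weight i : root_weight i ^+ 2 = (d i)%:R * ((d i)%:R - 1).
Proof. by rewrite sqr_sqrtr // natr_pred_ge0. Qed.

Lemma scaled_weight_ge0 i : 0 <= scaled_weight i.
Proof. by rewrite divr_ge0 // sqrtr_ge0. Qed.

Lemma lambdaE i j : lambda R d i j = scaled_weight i * scaled_weight j.
Proof.
rewrite /lambda /scaled_weight mulrACA -mulrA sqrtrM ?natr_pred_ge0 //.
congr (_ * _); rewrite -invfM -expr2 sqr_sqrtr // natrM; congr (_ ^-1 ).
Qed.

Lemma lambda_ge0 i j : 0 <= lambda R d i j.
Proof. by rewrite lambdaE mulr_ge0 // scaled_weight_ge0. Qed.

Lemma sqr_scaled_weight i : scaled_weight i ^+ 2 = lambda R d i i.
Proof. by rewrite lambdaE expr2. Qed.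

Definition limit_exponent : R :=
  - (1 / 2) * (\sum_(i < n) lambda R d i i)
  - \sum_(i < n) \sum_(j < n | (i < j)%N) (lambda R d i j - ln (1 + lambda R d i j)).

Lemma prod_limit_factor :
  \prod_(t : vertex_pair n)
    limit_factor t (scaled_weight (fst_end t) * scaled_weight (snd_end t)) =
  expR limit_exponent.
Proof.
pose F (i j : 'I_n) : R := if i == j then - (lambda R d i j / 2)
  else - (lambda R d i j - ln (1 + lambda R d i j)).
transitivity (\prod_(t : vertex_pair n) expR (F (fst_end t) (snd_end t))).
  apply: eq_bigr => t _; rewrite /limit_factor /F -lambdaE -/(is_loop t).
  case: ifP => // _; rewrite opprB expRD lnK // posrE.
  by apply: (@lt_le_trans _ _ 1) => //; rewrite lerDl lambda_ge0.
rewrite -expR_sum (big_vertex_pair _ F) /limit_exponent; congr expR.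
rewrite big_split /= mulr_sumr; congr (_ + _).
  by apply: eq_bigr => i _; rewrite /F eqxx; ring.
rewrite -sumrN; apply: eq_bigr => i _; rewrite -sumrN; apply: eq_bigr => j ij.
by rewrite /F -val_eqE /= (ltn_eqF ij).
Qed.

Let S : R := \sum_i lambda R d i i.

(** The first term is the majorant at the arguments 8 x_i, whose squares add up to 64 s. In the
    second, one argument is replaced by 8(1+s), and the prefactor s is the sum of the x_i^2. *)
Definition error_bound (s : R) : R :=
  majorant_bound (64 * s) + s * majorant_bound (s + 64 * (1 + s) ^+ 2).

Lemma prob_simple_close : (0 < N)%N ->
  `|prob_simple R d - expR limit_exponent| <= error_bound S / Num.sqrt (2 * N)%:R.
Proof.
move=> N0; set q := Num.sqrt (2 * N)%:R.
have Q1 : 1 <= (2 * N)%:R :> R by rewrite ler1n; lia.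
have q1 : 1 <= q by rewrite -[1]sqrtr1 ler_wsqrtr.
have q0 : 0 < q by exact: lt_le_trans q1.
have hq : q ^+ 2 = (2 * N)%:R by rewrite sqr_sqrtr.
have S0 : 0 <= S by apply: sumr_ge0 => i _; exact: lambda_ge0.
have sumS : \sum_i scaled_weight i ^+ 2 = S by apply: eq_bigr => i _; exact: sqr_scaled_weight.
(* This allows X = 1 + S; it follows from x_i^2 <= S and 2 x_i <= 1 + x_i^2. *)
have xX i : scaled_weight i <= 1 + S.
  have : scaled_weight i ^+ 2 <= S.
    rewrite -sumS (bigD1 i) //= lerDl; apply: sumr_ge0 => j _; exact: sqr_ge0.
  by have := sqr_ge0 (scaled_weight i - 1); nra.
have step D : (N <= D)%N ->
    `|prob_simple R d - truncated_product D scaled_weight| <= error_bound S / q.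
  move=> ND; rewrite (prob_simpleE sum_degrees).
  have := @simple_matchings_close R n _ vertex [set: half_edge d]%SET N D root_weight q (1 + S)
    N0 _ ND (fun i => sqrtr_ge0 _) _ q0 hq _ xX.
  rewrite card_half_edges sum_degrees => /(_ erefl).
  have hz i : root_weight i ^+ 2 = (degree vertex [set: half_edge d]%SET i)%:R *
      ((degree vertex [set: half_edge d]%SET i)%:R - 1).
    by rewrite degree_half_edges sqr_root_weight.
  move=> /(_ hz); rewrite lerDl => /(_ S0)/le_trans; apply.
  rewrite /error_bound [leRHS]mulrDl; apply: lerD.
    rewrite mulrC.
    apply: ler_pM; rewrite ?invr_ge0 //.
      by apply: prodr_ge0 => t _; apply: sumr_ge0 => k _; rewrite mulr_ge0 ?exprn_ge0 //
        mulr_ge0 // mulr_ge0 // scaled_weight_ge0.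
      have -> : 64 * S = \sum_i (8 * scaled_weight i) ^+ 2.
        by rewrite -sumS mulr_sumr; apply: eq_bigr => i _; ring.
      by apply: majorant_le => i; rewrite mulr_ge0 // scaled_weight_ge0.
    by rewrite lef_pV2 ?posrE // -?hq ?exprn_gt0 // expr2 ler_peMl // ltW.
  rewrite mulrC ler_wpM2r ?invr_ge0 ?(ltW q0) // -sumS mulr_suml sumS.
  apply: ler_sum => i _; rewrite ler_wpM2l ?sqr_ge0 //.
  have X0 : 0 <= 1 + S by rewrite addr_ge0.
  apply: (le_trans (majorant_le _ _)).
    by move=> j; case: ifP => _; [rewrite mulr_ge0|exact: scaled_weight_ge0].
  apply: majorant_bound_le; first by apply: sumr_ge0 => j _; exact: sqr_ge0.
  rewrite (bigD1 i) //= eqxx addrC lerD //; last by rewrite exprMn (_ : 8 ^+ 2 = 64) //; ring.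
  rewrite -sumS [leRHS](bigD1 i) //= -[leLHS]add0r lerD ?sqr_ge0 //.
  by apply: ler_sum => j /negPf->.
(* The bound in [step] is independent of D, so D may tend to infinity. *)
apply/ler_addgt0Pr => e e0.
have := @cvg_truncated_product R n scaled_weight; rewrite prod_limit_factor.
move/cvgrPdist_le => /(_ e e0) he.
have [D [ND hD]] : exists D, (N <= D)%N /\
    `|expR limit_exponent - truncated_product D scaled_weight| <= e.
  near \oo => D; exists D; split; near: D => //; exact: nbhs_infty_ge.
apply: le_trans (lerD (step D ND) hD); rewrite [`|expR _ - _|]distrC.
exact: ler_distD.
Unshelve. all: by end_near.
Qed.

End ConfigurationModel.

(** * Uniformity in the degree sequence, and the second form of the exponent *)

Section Uniform.
Variable R : realType.

Lemma error_bound_le (s u : R) : 0 <= s -> s <= u -> error_bound s <= error_bound u.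
Proof.
move=> s0 su; have u0 := le_trans s0 su.
apply: lerD.
  by apply: majorant_bound_le; [rewrite mulr_ge0|rewrite ler_wpM2l].
apply: ler_pM => //; first exact: expR_ge0.
apply: majorant_bound_le; first by rewrite addr_ge0 // mulr_ge0 // sqr_ge0.
by rewrite lerD // ler_wpM2l // lerXn2r ?nnegrE ?addr_ge0 // lerD2l.
Qed.

Lemma prob_simple_ge0 n (d : 'I_n -> nat) : 0 <= prob_simple R d.
Proof. exact: divr_ge0. Qed.

Lemma limit_exponent_le n (d : 'I_n -> nat) :
  limit_exponent R d <= - ((\sum_i lambda R d i i) / 2).
Proof.
rewrite /limit_exponent (_ : - (1 / 2) * _ = - ((\sum_i lambda R d i i) / 2)); last by ring.
rewrite gerDl oppr_le0; apply: sumr_ge0 => i _; apply: sumr_ge0 => j _.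
by rewrite subr_ge0 le_ln1Dx // (lt_le_trans _ (lambda_ge0 _ _ _ _)) // ltrN10.
Qed.

Lemma sum_lambda n (d : 'I_n -> nat) : (0 < num_edges d)%N ->
  \sum_i (d i)%:R * ((d i)%:R - 1) = (2 * num_edges d)%:R * \sum_i lambda R d i i.
Proof.
move=> N0; rewrite mulr_sumr; apply: eq_bigr => i _.
rewrite lambdaE -expr2 expr_div_n sqr_root_weight sqr_sqrtr // [RHS]mulrC divfK //.
by rewrite pnatr_eq0; lia.
Qed.

Lemma prob_simple_uniform (e : R) : 0 < e -> exists N0 : nat,
  forall n (d : 'I_n -> nat), ~~ odd (\sum_i d i) -> (N0 <= num_edges d)%N ->
  `|prob_simple R d - expR (limit_exponent R d)| <= e.
Proof.
(* The threshold between few and many expected loops: S > 8/e makes 2/S at most e/4. *)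
move=> e0; pose C : R := 8 / e; pose B := error_bound C.
have C0 : 0 < C by rewrite divr_gt0.
have B0 : 0 <= B.
  by apply: addr_ge0; [exact: expR_ge0 | apply: mulr_ge0; [exact: ltW | exact: expR_ge0]].
(* N > (B/e)^2 settles the case S <= C; N > 4/e + 3 makes the term 2/(2N-3) of the second moment
   bound at most e/2 when S > C. *)
pose r : R := (B / e) ^+ 2 + 4 / e + 3.
have e4 : 0 < 4 / e by rewrite divr_gt0.
have r0 : 0 <= r by rewrite !addr_ge0 ?sqr_ge0 // ltW.
exists (Num.bound r) => n d ev; set N := num_edges d => hN.
have rN : r < N%:R by apply: lt_le_trans (archi_boundP r0) _; rewrite ler_nat.
have Be0 := sqr_ge0 (B / e).
have N3 : (3 < N)%N by rewrite -(ltr_nat R); apply: le_lt_trans rN; rewrite /r; lra.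
have N0 : (0 < N)%N by lia.
set S := \sum_i lambda R d i i.
have S0 : 0 <= S by apply: sumr_ge0 => i _; exact: lambda_ge0.
have [SC|CS] := leP S C.
  apply: (le_trans (prob_simple_close R ev N0)).
  have q0 : 0 < Num.sqrt (2 * N)%:R :> R by rewrite sqrtr_gt0 ltr0n; lia.
  rewrite ler_pdivrMr //; apply: (le_trans (error_bound_le S0 SC)).
  rewrite -/B -ler_pdivrMl // mulrC -[leLHS]ger0_norm ?divr_ge0 ?(ltW e0) //.
  rewrite -sqrtr_sqr ler_wsqrtr // natrM.
  by move: rN; rewrite /r; lra.
have Sp : 0 < S by exact: lt_trans CS.
have hS : 2 / S <= e / 4.
  rewrite ler_pdivrMr // mulrC mulrA ler_pdivlMr //.
  by move: CS; rewrite /C ltr_pdivrMr // => /ltW; lra.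
(* From e^(-S/2) <= 1/(1 + S/2). *)
have hE : expR (limit_exponent R d) <= 2 / S.
  apply: (@le_trans _ _ (expR (- (S / 2)))); first by rewrite ler_expR limit_exponent_le.
  rewrite expRN -[2 / S]invf_div lef_pV2 ?posrE ?expR_gt0 ?divr_gt0 //.
  by apply: le_trans (expR_ge1Dx _); rewrite lerDr.
have hP : prob_simple R d <= 2 / S + e / 2.
  have hA := card_half_edges d; rewrite (sum_degrees ev) -/N in hA.
  have hd := sum_degrees ev; rewrite -/N in hd.
  have NM : N = (N - 2).+2 by lia.
  rewrite (prob_simpleE R hd) NM.
  rewrite NM in hA.
  apply: (le_trans (simple_matchings_second_moment (S := S) hA Sp _)).
    under eq_bigr do rewrite degree_half_edges.
    by rewrite -NM; exact: sum_lambda.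
  rewrite lerD2l ler_pdivrMr ?ltr0n // mulrAC ler_pdivlMr //.
  have -> : (2 * (N - 2)).+1%:R = 2 * N%:R - 3 :> R.
    by rewrite -natrM -natrB; [congr (_%:R); lia|lia].
  have : 4 <= e * (N%:R - 3).
    by rewrite -ler_pdivrMl // mulrC; move: rN; rewrite /r; lra.
  have := ler0n R N; nra.
have := expR_ge0 (limit_exponent R d); have := prob_simple_ge0 d.
by rewrite ler_norml; lra.
Qed.

Lemma sqr_sum n (a : 'I_n -> R) : (\sum_i a i) ^+ 2 =
  \sum_i a i ^+ 2 + 2 * \sum_(i < n) \sum_(j < n | (i < j)%N) a i * a j.
Proof.
rewrite expr2 mulr_suml.
transitivity (\sum_(i < n) (a i ^+ 2 + (\sum_(j < n | (i < j)%N) a i * a j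
    + \sum_(j < n | (j < i)%N) a i * a j))).
  apply: eq_bigr => i _; rewrite mulr_sumr (bigD1 i) //= -expr2; congr (_ + _).
  rewrite (bigID (fun j : 'I_n => (i < j)%N)) /=; congr (_ + _); apply: eq_bigl => j.
    by rewrite -val_eqE /=; lia.
  by rewrite -val_eqE /=; lia.
rewrite !big_split /=; congr (_ + _); rewrite mulr_natl mulr2n; congr (_ + _).
rewrite (exchange_big_dep predT) //=; apply: eq_bigr => i _; apply: eq_bigr => j _.
exact: mulrC.
Qed.

(** Writing d_i^2 = d_i + d_i (d_i - 1) turns the first quotient into 1 + S. Since the square of
    [lambda R d i j] is the product of the diagonal values at i and j, the quadratic terms add up to
    a quarter of S^2 and cancel. *)
Lemma limit_exponentE n (d : 'I_n -> nat) :
  ~~ odd (\sum_i d i) -> (0 < num_edges d)%N ->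
  - (1 / 4) * ((\sum_(i < n) (d i)%:R ^+ 2) / (2 * (num_edges d)%:R)) ^+ 2
  + 1 / 4
  + (\sum_(i < n) (d i)%:R ^+ 2 * ((d i)%:R - 1) ^+ 2) / (16 * (num_edges d)%:R ^+ 2)
  + \sum_(i < n) \sum_(j < n | (i < j)%N)
      (ln (1 + lambda R d i j) - lambda R d i j + 1 / 2 * lambda R d i j ^+ 2)
  = limit_exponent R d.
Proof.
move=> ev N0; have Nn : (num_edges d)%:R != 0 :> R by rewrite pnatr_eq0 -lt0n.
set S := \sum_i lambda R d i i.
have -> : (\sum_(i < n) (d i)%:R ^+ 2) / (2 * (num_edges d)%:R) = 1 + S.
  have : \sum_(i < n) (d i)%:R ^+ 2 = (2 * num_edges d)%:R + (2 * num_edges d)%:R * S.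
    rewrite -sum_lambda // -{1}(sum_degrees ev) natr_sum -big_split /=.
    by apply: eq_bigr => i _; ring.
  by move=> ->; rewrite natrM; field.
have -> : (\sum_(i < n) (d i)%:R ^+ 2 * ((d i)%:R - 1) ^+ 2) / (16 * (num_edges d)%:R ^+ 2)
    = (\sum_i lambda R d i i ^+ 2) / 4.
  rewrite !mulr_suml; apply: eq_bigr => i _.
  rewrite lambdaE -expr2 expr_div_n sqr_root_weight sqr_sqrtr // natrM.
  by field.
have -> : \sum_(i < n) \sum_(j < n | (i < j)%N)
      (ln (1 + lambda R d i j) - lambda R d i j + 1 / 2 * lambda R d i j ^+ 2) =
   - \sum_(i < n) \sum_(j < n | (i < j)%N) (lambda R d i j - ln (1 + lambda R d i j))
   + 1 / 2 * \sum_(i < n) \sum_(j < n | (i < j)%N) lambda R d i i * lambda R d j j.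
  rewrite mulr_sumr -sumrN -big_split; apply: eq_bigr => i _ /=.
  rewrite mulr_sumr -sumrN -big_split; apply: eq_bigr => j _ /=.
  by rewrite !lambdaE; ring.
have := sqr_sum (fun i => lambda R d i i); rewrite -/S => hs.
rewrite /limit_exponent -/S; move: hs; move: (\sum_i \sum_(j < n | _) _ * _) => P.
move: (\sum_i lambda R d i i ^+ 2) (\sum_i \sum_(j < n | _) _) => Q L hs.
by lra.
Qed.

End Uniform.

Unset Implicit Arguments.
Set Strict Implicit.

Theorem theorem1p4 (R : realType) (n : nat -> nat)
    (d : forall nu : nat, 'I_(n nu) -> nat)
    (hn : forall nu : nat, (1 <= nu)%N -> (1 <= n nu)%N)
    (heven : forall nu : nat, (1 <= nu)%N -> ~~ odd (\sum_i d nu i)%N)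
    (hN : (fun nu : nat => num_edges (d nu)) @ \oo --> \oo) :
  ((fun nu : nat => prob_simple R (d nu)
     - expR (- (1 / 2) * (\sum_(i < n nu) lambda R (d nu) i i)
             - \sum_(i < n nu) \sum_(j < n nu | (i < j)%N)
                 (lambda R (d nu) i j - ln (1 + lambda R (d nu) i j))))
   @ \oo --> (0 : R))
  /\
  ((fun nu : nat => prob_simple R (d nu)
     - expR (- (1 / 4) * ((\sum_(i < n nu) (d nu i)%:R ^+ 2)
                          / (2 * (num_edges (d nu))%:R)) ^+ 2
             + 1 / 4
             + (\sum_(i < n nu) (d nu i)%:R ^+ 2 * ((d nu i)%:R - 1) ^+ 2)
               / (16 * (num_edges (d nu))%:R ^+ 2)
             + \sum_(i < n nu) \sum_(j < n nu | (i < j)%N)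
                 (ln (1 + lambda R (d nu) i j) - lambda R (d nu) i j
                  + 1 / 2 * lambda R (d nu) i j ^+ 2)))
   @ \oo --> (0 : R)).
Proof.
move/cvgnyPge: hN => hN.
split; apply/cvgrPdist_le => e e0; have [N0 hN0] := prob_simple_uniform e0; near=> nu.
  rewrite sub0r normrN; apply: hN0; first by apply: heven; near: nu; exact: nbhs_infty_ge.
  by near: nu; exact: hN.
(* Evenness is assumed only from index 1 on, which holds eventually. *)
have ev : ~~ odd (\sum_i d nu i) by apply: heven; near: nu; exact: nbhs_infty_ge.
rewrite sub0r normrN limit_exponentE //.
  by apply: hN0 => //; near: nu; exact: hN.
by near: nu; exact: hN.
Unshelve. all: by end_near.
Qed.
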